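(* Let $\mathbf u\in\mathbf H_0^1(\Omega)$, $\operatorname{div}\mathbf u=0$, be the minimizer of $J$ over divergence-free fields of $\mathbf H_0^1(\Omega)$, and let $p\in L_0^2(\Omega)$ be the associated pressure, i.e. $$\langle J'(\mathbf u),\mathbf v\rangle_{\mathbf H^{-1},\mathbf H_0^1}=\int_\Omega p\,\operatorname{div}\mathbf v\,dx\qquad\forall\,\mathbf v\in\mathbf H_0^1(\Omega).$$ For $\sigma>0$ let $\mathbf u_\sigma$ be the minimizer over $\mathbf H_0^1(\Omega)$ of $J_\sigma(\mathbf v)=J(\mathbf v)+\sigma\|\operatorname{div}\mathbf v\|_{L^1(\Omega)}$, and let $\zeta\in L_0^2(\Omega)$, with $|\zeta|\le\sigma$ a.e. in $\Omega$, be a multiplier of the optimality condition $$\langle -J'(\mathbf u_\sigma),\mathbf v\rangle_{\mathbf H^{-1},\mathbf H_0^1}=(\zeta,\operatorname{div}\mathbf v)_{L^2}\qquad\forall\,\mathbf v\in\mathbf H_0^1(\Omega).$$ Let $\sigma_0>0$ be such that $\operatorname{div}\mathbf u_\sigma=0$ for all $\sigma\ge\sigma_0$. Then, for all $\sigma\ge\sigma_0$, $-\zeta=p$.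
   Context: $\Omega\subset\mathbb R^n$, $n\in\{2,3\}$, is open and bounded with Lipschitz boundary; $\mathbf H_0^1(\Omega)=(H_0^1(\Omega))^n$ with dual $\mathbf H^{-1}(\Omega)$; $L_0^2(\Omega)$ is the space of $L^2(\Omega)$ functions with zero mean. $\mathcal E\mathbf u$ is the symmetric gradient with entries $\mathcal E_{ij}(\mathbf u)=\frac12\left(\frac{\partial u_i}{\partial x_j}+\frac{\partial u_j}{\partial x_i}\right)$; $A:B=\mathrm{tr}(AB^\top)$, $|A|=\sqrt{A:A}$. Let $\mu,g,\beta>0$ and let $\mathbf f$ be such that $\mathbf u\mapsto\int_\Omega\mathbf f\cdot\mathbf u\,dx$ is continuous and linear on $\mathbf H_0^1(\Omega)$. Define $$J(\mathbf u)=\mu\int_\Omega\mathcal E\mathbf u:\mathcal E\mathbf u\,dx+\int_\Omega\Psi(\mathcal E\mathbf u)\,dx-\int_\Omega\mathbf f\cdot\mathbf u\,dx,$$ with $\Psi(A)=g|A|-\frac{g^2}{2\beta}$ if $|A|\ge g/\beta$ and $\Psi(A)=\frac\beta2|A|^2$ if $|A|<g/\beta$. Its Fréchet derivative is $$\langle J'(\mathbf u),\mathbf v\rangle_{\mathbf H^{-1},\mathbf H_0^1}=2\mu\int_\Omega\mathcal E\mathbf u:\mathcal E\mathbf v\,dx+g\beta\int_\Omega\frac{\mathcal E\mathbf u:\mathcal E\mathbf v}{\max(g,\beta|\mathcal E\mathbf u|)}\,dx-\int_\Omega\mathbf f\cdot\mathbf v\,dx .$$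
   Formalization: Ω is additionally assumed connected: on two disjoint balls with f = 0, u = u_σ = 0, p = 0, a ζ that is a nonzero constant on each ball with zero total mean and |ζ| ≤ σ meets every hypothesis, yet −ζ ≠ p. *)

(* Defs.v *)
From HB Require Import structures.
From mathcomp Require Import all_boot all_order all_algebra.
From mathcomp Require Import all_classical all_reals all_analysis.

Set Implicit Arguments.
Unset Strict Implicit.
Unset Printing Implicit Defensive.

Import Order.TTheory GRing.Theory Num.Theory.
Import numFieldTopology.Exports numFieldNormedType.Exports.

Local Open Scope classical_set_scope.
Local Open Scope ring_scope.

(* Points of R^n are row vectors.  The library's topology on 'rV[R]_n is that
   of the sup norm, which is the usual one; the sigma-algebra below, generated
   by the coordinates, is the Borel one. *)

Definition rV_display : measure_display. Proof. exact: default_measure_display. Qed.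

Section measurable_rV.
Context {R : realType} {n : nat}.

Definition rV_coord (i : 'I_n) (x : 'rV[R]_n) : R := x 0 i.

Let rV_set0 : g_sigma_preimage rV_coord set0.
Proof. exact: sigma_algebra0. Qed.

Let rV_setC A : g_sigma_preimage rV_coord A -> g_sigma_preimage rV_coord (~` A).
Proof. exact: sigma_algebraC. Qed.

Let rV_bigcup (F : (set 'rV[R]_n)^nat) :
  (forall i, g_sigma_preimage rV_coord (F i)) ->
  g_sigma_preimage rV_coord (\bigcup_i (F i)).
Proof. exact: sigma_algebra_bigcup. Qed.

HB.instance Definition _ := @isMeasurable.Build rV_display
  'rV[R]_n (g_sigma_preimage rV_coord) rV_set0 rV_setC rV_bigcup.

Lemma measurable_rV_coord (i : 'I_n) : measurable_fun setT (rV_coord i).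
Proof.
move=> _ Y mY; rewrite setTI; apply: sub_sigma_algebra => /=.
rewrite -bigcup_seq/=; exists i => /=; first by rewrite mem_index_enum.
by exists Y => //; rewrite setTI.
Qed.

Lemma measurable_fun_rVP d (T : measurableType d) (f : T -> 'rV[R]_n) :
  measurable_fun setT f <-> forall i, measurable_fun setT (rV_coord i \o f).
Proof.
split=> [mf i|mf].
  by apply: measurableT_comp => //; exact: measurable_rV_coord.
have prefS : g_sigma_preimage (fun i => rV_coord i \o f) `<=` measurable.
  apply: smallest_sub; first exact: sigma_algebra_measurable.
  move=> A; rewrite -bigcup_seq/= => -[i _ [B mB <-]].
  exact: mf.
move=> _ A mA; apply: prefS.
by rewrite g_sigma_preimage_comp; exists A.
Qed.

End measurable_rV.

Section lebesgue_rV.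
Context {R : realType}.

Definition rV_cons n (x : measurableTypeR R * 'rV[R]_n) : 'rV[R]_n.+1 :=
  \row_i (if unlift ord0 i is Some j then x.2 0 j else x.1).

Definition rV_uncons n (x : 'rV[R]_n.+1) : measurableTypeR R * 'rV[R]_n :=
  (x 0 ord0, \row_i x 0 (lift ord0 i)).

Lemma rV_consK n : cancel (@rV_cons n) (@rV_uncons n).
Proof.
move=> [a v]; rewrite /rV_cons /rV_uncons mxE unlift_none/=; congr pair.
by apply/rowP => i; rewrite !mxE liftK.
Qed.

Lemma rV_unconsK n : cancel (@rV_uncons n) (@rV_cons n).
Proof.
by move=> x; apply/rowP => i; rewrite mxE; case: unliftP => [j ->|->//]; rewrite mxE.
Qed.

Lemma measurable_rV_cons n : measurable_fun setT (@rV_cons n).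
Proof.
apply/measurable_fun_rVP => i.
case: (unliftP ord0 i) => [j ->|->].
  rewrite (_ : _ \o _ = rV_coord j \o snd); last first.
    by apply/funext => x; rewrite /rV_coord/= mxE liftK.
  by apply: measurableT_comp => //; exact: measurable_rV_coord.
rewrite (_ : _ \o _ = fst) //.
by apply/funext => x; rewrite /rV_coord/= mxE unlift_none.
Qed.

Lemma measurable_rV_uncons n : measurable_fun setT (@rV_uncons n).
Proof.
apply: measurable_fun_pair => /=.
  exact: (@measurable_rV_coord R n.+1 ord0).
apply/measurable_fun_rVP => i.
rewrite (_ : _ \o _ = rV_coord (lift ord0 i)); first exact: measurable_rV_coord.
by apply/funext => x; rewrite /rV_coord/= mxE.
Qed.

Section step.
Variables (n : nat) (m : {sigma_finite_measure set 'rV[R]_n -> \bar R}).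

Definition leb_step : set 'rV[R]_n.+1 -> \bar R :=
  pushforward (lebesgue_measure \x m)%E (@rV_cons n).

HB.instance Definition _ := Measure.copy leb_step
  (measure_function_pushforward__canonical__measure_function_Measure
    (lebesgue_measure \x m)%E (@measurable_rV_cons n)).

Lemma leb_step_sigma_finite : sigma_finite setT leb_step.
Proof.
have [F FT Ffin] : sigma_finite setT (lebesgue_measure \x m)%E.
  have /sigma_finiteP[F [TF ndF Foo]] := sigma_finiteT (@lebesgue_measure R).
  have /sigma_finiteP[G [TG ndG Goo]] := sigma_finiteT m.
  exists (fun k => F k `*` G k) => [|k].
    rewrite -setXTT TF TG; apply/seteqP; split=> -[x y] /=.
      move=> [[j _ Fjx] [k _ Gky]]; exists (maxn j k) => //; split.
      - by move: x Fjx; exact/subsetPset/ndF/leq_maxl.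
      - by move: y Gky; exact/subsetPset/ndG/leq_maxr.
    by move=> [k _ [Fx Gy]]; split; exists k.
  have [? ?] := Foo k; have [? ?] := Goo k.
  split; first exact: measurableX.
  by rewrite product_measure1E// lte_mul_pinfty// ge0_fin_numE.
have consE A : @rV_cons n @^-1` (@rV_uncons n @^-1` A) = A.
  by rewrite -comp_preimage; apply/seteqP; split=> x /=; rewrite rV_consK.
exists (fun k => @rV_uncons n @^-1` (F k)) => [|k].
  by rewrite -preimage_bigcup -FT preimage_setT.
have [mFk Fkoo] := Ffin k; split; last by rewrite /leb_step /pushforward consE.
by rewrite -[X in measurable X]setTI; exact: measurable_rV_uncons.
Qed.

HB.instance Definition _ :=
  Measure_isSigmaFinite.Build _ _ _ leb_step leb_step_sigma_finite.

End step.

(* n-dimensional Lebesgue measure: Lebesgue measure on R times the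
   (n-1)-dimensional one. *)
Fixpoint leb n : {sigma_finite_measure set 'rV[R]_n -> \bar R} :=
  match n with
  | 0 => \d_(0 : 'rV[R]_0)
  | n.+1 => leb_step (leb n)
  end.

(* This determines [leb n] among the sigma-finite Borel measures. *)
Lemma leb_box n (A : 'I_n -> set (measurableTypeR R)) :
  (forall i, measurable (A i)) ->
  leb n [set x | forall i, A i (x 0 i)] = (\prod_(i < n) lebesgue_measure (A i))%E.
Proof.
elim: n A => [|n IHn] A mA.
  rewrite big_ord0 /= diracE mem_set//.
  by case.
have mB : measurable [set x : 'rV[R]_n | forall i, A (lift ord0 i) (x 0 i)].
  rewrite (_ : [set _ | _] =
      \bigcap_(i in [set: 'I_n]) (@rV_coord R n i @^-1` A (lift ord0 i))); last first.
    apply/seteqP; split=> x h i; first by move=> _; exact: h.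
    exact: (h i Logic.I).
  apply: fin_bigcap_measurable => // i _.
  have := @measurable_rV_coord R n i measurableT _ (mA (lift ord0 i)).
  by rewrite setTI.
rewrite big_ord_recl -IHn// -product_measure1E//=.
rewrite /leb_step /pushforward; congr (_ _).
apply/seteqP; split=> -[a v] /=.
  move=> h; split=> [|i]; first by have := h ord0; rewrite mxE unlift_none.
  by have := h (lift ord0 i); rewrite mxE liftK.
by move=> [ha hv] i; rewrite mxE; case: unliftP => [j ->|->].
Qed.

End lebesgue_rV.

Section sobolev.
Context {R : realType} {n : nat}.
Variable Omega : set 'rV[R]_n.

Definition dotv (x y : 'rV[R]_n) : R := \sum_i x 0 i * y 0 i.

(* Near each boundary point, Omega is the open region above the graph of a
   Lipschitz function over the hyperplane orthogonal to a unit vector e: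
   [y - dotv y e *: e] is the component of y in that hyperplane and [dotv y e]
   its height.  Only the restriction of gamma to the hyperplane matters. *)
Definition lipschitz_boundary :=
  forall x, (closure Omega `\` interior Omega) x ->
  exists (e : 'rV[R]_n) (gamma : 'rV[R]_n -> R) (k : R),
    [/\ dotv e e = 1, k.-lipschitz gamma &
        \forall y \near x, Omega y <-> gamma (y - dotv y e *: e) < dotv y e].

Definition ae_in (P : 'rV[R]_n -> Prop) := {ae leb n, forall x, Omega x -> P x}.

Definition pderiv (i : 'I_n) (phi : 'rV[R]_n -> R) (x : 'rV[R]_n) : R :=
  'D_(delta_mx 0 i : 'rV[R]_n) phi x.

(* C^oo: every iterated partial derivative is everywhere differentiable. *)
Definition smooth (phi : 'rV[R]_n -> R) :=
  forall (s : seq 'I_n) x, differentiable (foldr pderiv phi s) x.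

Definition test_function (phi : 'rV[R]_n -> R) :=
  smooth phi /\ exists K : set 'rV[R]_n,
    [/\ compact K, K `<=` Omega & forall x, ~ K x -> phi x = 0].

(* Functions are representatives, defined on all of R^n; only their values
   (almost everywhere) on Omega matter. *)
Definition L2 (w : 'rV[R]_n -> R) :=
  measurable_fun Omega w /\
  (leb n).-integrable Omega (fun x => (w x ^+ 2)%:E).

Definition L20 (w : 'rV[R]_n -> R) := L2 w /\ \int[leb n]_(x in Omega) w x = 0.

Definition is_weak_partial (i : 'I_n) (w h : 'rV[R]_n -> R) :=
  forall phi, test_function phi ->
  \int[leb n]_(x in Omega) (w x * pderiv i phi x) =
  - \int[leb n]_(x in Omega) (h x * phi x).

Definition H1 (w : 'rV[R]_n -> R) :=
  L2 w /\ forall i, exists h, L2 h /\ is_weak_partial i w h.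

(* The weak partial derivative is unique up to a null set; a representative is
   chosen.  The default value is irrelevant for w in H1. *)
Definition wpartial (i : 'I_n) (w : 'rV[R]_n -> R) : 'rV[R]_n -> R :=
  xget (cst 0) [set h | L2 h /\ is_weak_partial i w h].

Definition H1sqnorm (w : 'rV[R]_n -> R) : R :=
  \int[leb n]_(x in Omega) (w x ^+ 2)
  + \sum_(i < n) \int[leb n]_(x in Omega) (wpartial i w x ^+ 2).

(* closure of the test functions in H1 *)
Definition H10 (w : 'rV[R]_n -> R) :=
  H1 w /\ forall eps : R, 0 < eps ->
    exists2 phi, test_function phi & Num.sqrt (H1sqnorm (w - phi)) < eps.

Definition vfield := 'rV[R]_n -> 'rV[R]_n.

Definition component (u : vfield) (i : 'I_n) : 'rV[R]_n -> R := fun x => u x 0 i.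

Definition vH10 (u : vfield) := forall i, H10 (component u i).

Definition vH1norm (u : vfield) : R := Num.sqrt (\sum_(i < n) H1sqnorm (component u i)).

Definition vH10_dual (L : vfield -> R) :=
  (forall a u v, vH10 u -> vH10 v -> L (a *: u + v) = a * L u + L v) /\
  exists C : R, forall u, vH10 u -> `|L u| <= C * vH1norm u.

Definition wgrad (u : vfield) (x : 'rV[R]_n) : 'M[R]_n :=
  \matrix_(i, j) wpartial j (component u i) x.

Definition symgrad (u : vfield) (x : 'rV[R]_n) : 'M[R]_n :=
  \matrix_(i, j) (2^-1 * (wgrad u x i j + wgrad u x j i)).

Definition wdiv (u : vfield) (x : 'rV[R]_n) : R := \sum_i wpartial i (component u i) x.

Definition solenoidal (u : vfield) := ae_in (fun x => wdiv u x = 0).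

End sobolev.

Definition is_minimizer (R : realType) (T : Type) (F : T -> R) (A : set T) (u : T) :=
  A u /\ forall v, A v -> F u <= F v.

Section functional.
Context {R : realType} {n : nat}.
Variables (Omega : set 'rV[R]_n) (mu g beta : R) (f : @vfield R n).
Local Notation E := (symgrad Omega).

Definition dotm (A B : 'M[R]_n) : R := \tr (A *m B^T).
Definition normm (A : 'M[R]_n) : R := Num.sqrt (dotm A A).

Definition Psi (A : 'M[R]_n) : R :=
  if g / beta <= normm A then g * normm A - g ^+ 2 / (2 * beta)
  else beta / 2 * normm A ^+ 2.

Definition load (u : vfield) : R := \int[leb n]_(x in Omega) dotv (f x) (u x).

Definition admissible_load :=
  (forall u, vH10 Omega u ->
    (leb n).-integrable Omega (fun x => (dotv (f x) (u x))%:E)) /\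
  vH10_dual Omega load.

Definition J (u : vfield) : R :=
  mu * \int[leb n]_(x in Omega) dotm (E u x) (E u x)
  + \int[leb n]_(x in Omega) Psi (E u x)
  - load u.

(* <J'(u), v>, the Frechet derivative of J at u applied to v; the derivative of
   Psi at A is B |-> g * beta * (A : B) / max(g, beta * |A|) in both cases. *)
Definition dJ (u v : vfield) : R :=
  2 * mu * \int[leb n]_(x in Omega) dotm (E u x) (E v x)
  + g * beta * \int[leb n]_(x in Omega)
      (dotm (E u x) (E v x) / Num.max g (beta * normm (E u x)))
  - load v.

Definition Jpen (sigma : R) (v : vfield) : R :=
  J v + sigma * \int[leb n]_(x in Omega) `|wdiv Omega v x|.

End functional.

(* Main.v *)
Require Import Defs.
From mathcomp Require Import all_boot all_order all_algebra.
From mathcomp Require Import all_classical all_reals all_analysis.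
From mathcomp Require Import measurable_realfun ring lra.
Import Order.TTheory GRing.Theory Num.Theory.
Import numFieldTopology.Exports numFieldNormedType.Exports.
Local Open Scope classical_set_scope.
Local Open Scope ring_scope.

Set Implicit Arguments.
Unset Strict Implicit.
Unset Printing Implicit Defensive.

(* Both [u] and [u_ sigma] lie in H^1_0 and are divergence free, so the two
   multiplier equations tested with [u] and [u_ sigma] give
   <J'(u) - J'(u_sigma), u - u_sigma> = 0.  As A |-> A / max(g, beta |A|) is monotone,
   the viscous term forces E u = E u_sigma almost everywhere, so that
   J'(u) = J'(u_sigma), and w := p + zeta satisfies int w div v = 0 for all v in H^1_0.

   It remains to see that such a w vanishes.  Testing with v = phi e_i, where phi is a
   tensor product of one-dimensional bumps supported in a closed box of Omega, shows that
   w has zero weak gradient.  On the box, a bump f of one variable is the sum of a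
   derivative of a bump and of a multiple of a fixed bump rho, so
   int w phi = (prod_i int phi_i / int rho_i) int w rho_1...rho_n.  The same holds for the
   constant 1 in place of w; hence w - c kills all tensor bumps for a suitable c, and
   w = c almost everywhere on the box.  Connectedness of Omega makes c global, and the
   zero mean gives c = 0. *)

(** * Smooth functions of one variable *)

Section smooth1.
Context {R : realType}.
Implicit Types (f g : R -> R) (P : {poly R}).

Definition smooth1 f := forall k x, derivable (derive1n k f) x 1.

(** Induction on the order keeps every iterated derivative inside [C], where derivability is known.
    Smoothness of a whole family thus reduces to a single differentiation. *)
Lemma smooth1_coind (C : set (R -> R)) :
  (forall f, C f -> (forall x, derivable f x 1) /\ C (derive1 f)) ->
  forall f, C f -> smooth1 f.
Proof.
move=> CP f Cf k; suff : C (derive1n k f) by move=> /CP[].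
by elim: k => [|k IHk]; rewrite ?derive1n0// derive1nS; have [] := CP _ IHk.
Qed.

Lemma smooth1_derivable f x : smooth1 f -> derivable f x 1.
Proof. by move=> /(_ 0%N). Qed.

Lemma smooth1_derive f : smooth1 f -> smooth1 (derive1 f).
Proof. by move=> sf k x; have := sf k.+1 x; rewrite derive1Sn. Qed.

Lemma smooth1_of_derive f :
  (forall x, derivable f x 1) -> smooth1 (derive1 f) -> smooth1 f.
Proof.
by move=> df sf [|k] x; [exact: df|rewrite derive1Sn; exact: sf].
Qed.

Lemma smooth1_continuous f : smooth1 f -> continuous f.
Proof.
by move=> sf x; apply/differentiable_continuous/derivable1_diffP; exact: (sf 0%N).
Qed.

(* This closure is stable under differentiation, hence consists of smooth functions
   by [smooth1_coind]. *)
Inductive smooth1_alg : (R -> R) -> Prop :=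
| Smooth1_base f : smooth1 f -> smooth1_alg f
| Smooth1_add f g : smooth1_alg f -> smooth1_alg g -> smooth1_alg (f + g)
| Smooth1_mul f g : smooth1_alg f -> smooth1_alg g -> smooth1_alg (f * g)
| Smooth1_aff f c d : smooth1_alg f -> smooth1_alg (fun x => f (c * x + d)).

Lemma smooth1_cst c : smooth1 (cst c).
Proof.
apply: (@smooth1_coind [set f | exists c, f = cst c]); last by exists c.
move=> _ [{}c ->]; split=> [x|]; first exact: derivable_cst.
by exists 0; apply/funext => x; rewrite derive1E derive_cst.
Qed.

Lemma smooth1_algP f : smooth1_alg f -> smooth1 f.
Proof.
apply: smooth1_coind => {}f; elim=> {f}.
- move=> f sf; split=> [x|]; first exact: (sf 0%N).
  exact/Smooth1_base/smooth1_derive.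
- move=> f g _ [df af] _ [dg ag]; split=> [x|]; first exact: derivableD.
  rewrite (_ : (derive1 _) = (derive1 f) + (derive1 g)); first exact: Smooth1_add.
  by apply/funext => x; rewrite derive1E deriveD// -!derive1E.
- move=> f g Af [df af] Ag [dg ag]; split=> [x|]; first exact: derivableM.
  rewrite (_ : (derive1 _) = (derive1 f) * g + f * (derive1 g)).
    by apply: Smooth1_add; exact: Smooth1_mul.
  apply/funext => x; rewrite derive1E deriveM// -!derive1E/=.
  by rewrite addrC /GRing.scale/= mulrC.
- move=> f c d _ [df af].
  have dl x : is_derive x (1:R) (fun x : R => c * x + d) c.
    rewrite (_ : (fun x => _) = c *: (@id R) + cst d)//.
    by apply: is_derive_eq; rewrite addr0 /GRing.scale/= mulr1.
  have H x : is_derive x (1:R) (fun x => f (c * x + d)) (c * (derive1 f) (c * x + d)).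
    have dfx := derivableP (df (c * x + d)).
    have := @is_derive1_comp _ f (fun x => c * x + d) x _ _ dfx (dl x).
    by rewrite derive1E mulrC.
  split=> [x|]; first by have [] := H x.
  rewrite (_ : (derive1 _) = cst c * (fun x => (derive1 f) (c * x + d))).
    by apply: Smooth1_mul; [exact/Smooth1_base/smooth1_cst|exact: Smooth1_aff].
  by apply/funext => x; rewrite derive1E; have /@derive_val -> := H x.
Qed.

Lemma smooth1D f g : smooth1 f -> smooth1 g -> smooth1 (f + g).
Proof. by move=> sf sg; apply/smooth1_algP/Smooth1_add; exact: Smooth1_base. Qed.

Lemma smooth1M f g : smooth1 f -> smooth1 g -> smooth1 (f * g).
Proof. by move=> sf sg; apply/smooth1_algP/Smooth1_mul; exact: Smooth1_base. Qed.

Lemma smooth1_affine f c d : smooth1 f -> smooth1 (fun x => f (c * x + d)).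
Proof. by move=> sf; apply/smooth1_algP/Smooth1_aff; exact: Smooth1_base. Qed.

(** The classical exp(-1/t) is the case P = 1. The polynomial in 1/t makes the family closed under
    differentiation, as [smooth1_coind] requires. *)
Definition flat P (t : R) : R := if 0 < t then P.[t^-1] * expR (- t^-1) else 0.

(** Up to the factor k!, the power s^k is a term of the exponential series. This bounds [flat P]
    near 0, where s = 1/t is large. *)
Lemma exprn_expRN_le k (s : R) : 0 <= s -> s ^+ k * expR (- s) <= k`!%:R.
Proof.
move=> s0; rewrite expRN ler_pdivrMr ?expR_gt0//; case: k => [|k].
  by rewrite expr0 fact0 mul1r -expR0 ler_expR.
rewrite -ler_pdivrMl ?ltr0n ?fact_gt0// mulrC.
by apply: le_trans (expR_ge1Dxn k s0); rewrite lerDr.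
Qed.

Lemma flat_bounded P : exists M, forall t, `|flat P t| <= M.
Proof.
exists (\sum_(i < size P) `|P`_i| * i`!%:R) => t; rewrite /flat.
case: ifPn => [t0|_]; last by rewrite normr0 sumr_ge0// => i _; rewrite mulr_ge0.
have s0 : 0 <= t^-1 by rewrite invr_ge0 ltW.
rewrite normrM (ger0_norm (expR_ge0 _)) horner_coef.
apply: (@le_trans _ _ (\sum_(i < size P) (`|P`_i| * t^-1 ^+ i * expR (- t^-1)))).
  rewrite -mulr_suml ler_wpM2r ?expR_ge0//.
  apply: le_trans (ler_norm_sum _ _ _) _; apply: ler_sum => i _.
  by rewrite normrM (ger0_norm (exprn_ge0 _ s0)).
by apply: ler_sum => i _; rewrite -mulrA ler_wpM2l// exprn_expRN_le.
Qed.

(** Trades a factor t for a factor X in the polynomial, which shows that [flat P] vanishes to any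
    order at 0. *)
Lemma flat_mulX P t : flat P t = t * flat ('X * P) t.
Proof.
rewrite /flat; case: ifPn => [t0|_]; last by rewrite mulr0.
by rewrite hornerM hornerX !mulrA divff ?mul1r// gt_eqF.
Qed.

(** For x > 0 the product and chain rules give x^-2 (P - P')(1/x) exp(-1/x), hence the polynomial
    X^2 (P - P'). The only delicate point is x = 0. *)
Lemma is_derive_flat P x :
  is_derive x (1:R) (flat P) (flat ('X^2 * (P - P^`())) x).
Proof.
have [x0|x0|->] := ltgtP x 0.
- rewrite {2}/flat ltNge (ltW x0)/=.
  apply: (@near_eq_is_derive _ _ _ (cst 0)) => /=.
  near=> y; rewrite /flat ltNge ltW//=.
  by near: y; exact: lt_nbhsl.
- rewrite {2}/flat x0.
  apply: (@near_eq_is_derive _ _ _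
     (fun y : R => P.[y^-1] * expR (- y^-1))) => /=.
    by near=> y; rewrite /flat ifT//; near: y; exact: lt_nbhsr.
  have dV : is_derive x (1:R) (fun y : R => y^-1) (- x ^- 2).
    apply: is_derive_eq; first by apply: is_deriveV; rewrite gt_eqF.
    by rewrite /GRing.scale/= mulr1.
  have dP : is_derive x (1:R) (fun y : R => P.[y^-1]) (P^`().[x^-1] * (- x ^- 2)).
    have := @is_derive1_comp _ (horner P) (fun y : R => y^-1) x _ _ _ dV.
    by apply; rewrite derivE derive1E; exact: derivableP.
  have dE : is_derive x (1:R) (fun y : R => expR (- y^-1)) (expR (- x^-1) * x ^- 2).
    have := @is_derive1_comp _ expR (fun y : R => - y^-1) x (expR (- x^-1)) (x^-2) _ _.
    apply; rewrite -[x ^- 2]opprK; exact: is_deriveN.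
  apply: is_derive_eq.
  rewrite hornerM hornerXn !hornerE /GRing.scale/= exprVn.
  ring.
- rewrite {2}/flat ltxx.
  (* Extracting two factors makes [flat P h] equal to h^2 times a quantity bounded by M, so the
     difference quotient at 0 is at most |h| (M + 1). The added 1 makes the later divisor
     positive. *)
  have [M HM] := flat_bounded ('X * ('X * P)).
  have H : (fun h : R => h^-1 *: (flat P (h *: 1 + 0) - flat P 0)) @ 0^' --> (0 : R).
    have -> : flat P 0 = 0 by rewrite /flat ltxx.
    have M0 : 0 < M + 1.
      by rewrite ltr_pwDr// (le_trans _ (HM 0)).
    apply/cvgr0Pnorm_le => e e0.
    near=> h.
    have h0 : h != 0 by near: h; exact: nbhs_dnbhs_neq.
    rewrite subr0 addr0 /GRing.scale/= mulr1 flat_mulX flat_mulX mulKf//.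
    rewrite normrM; apply: (@le_trans _ _ (`|h| * (M + 1))).
      by rewrite ler_wpM2l// (le_trans (HM _))// lerDl.
    rewrite -ler_pdivlMr//.
    by near: h; apply: dnbhs0_le; rewrite divr_gt0.
  apply: DeriveDef; first by apply/cvg_ex; exists 0.
  exact: cvg_lim.
Unshelve. all: by end_near. Qed.

Lemma smooth1_flat P : smooth1 (flat P).
Proof.
apply: (@smooth1_coind [set f | exists P, f = flat P]); last by exists P.
move=> _ [{}P ->]; split=> [x|]; first by have [] := is_derive_flat P x.
exists ('X^2 * (P - P^`())); apply/funext => x.
by rewrite derive1E; have /@derive_val -> := is_derive_flat P x.
Qed.

End smooth1.

(** * Bump functions of one variable *)

Section bump_functions.
Context {R : realType}.
Local Notation lambda := (@lebesgue_measure R).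
Implicit Types (f g : R -> R) (a b c x : R).

(** No order between a and b is imposed: for b < a only the zero function qualifies. Empty
    intersections of boxes then need no separate treatment. *)
Definition bumpfun a b f := smooth1 f /\ forall x, x < a \/ b < x -> f x = 0.

Lemma bump_derive a b f : bumpfun a b f -> bumpfun a b (derive1 f).
Proof.
move=> [sf f0]; split=> [|x xab]; first exact: smooth1_derive.
rewrite derive1E -[RHS](derive_cst (0 : R) x (1 : R)); apply: near_eq_derive => /=.
case: xab => [xa|bx].
- by near=> y; apply: f0; left; near: y; exact: lt_nbhsl.
- by near=> y; apply: f0; right; near: y; exact: lt_nbhsr.
Unshelve. all: by end_near. Qed.

(** By continuity a bump also vanishes at the endpoints, so a tensor product of bumps vanishes off
    the open box and not merely off the closed one. *)
Lemma bump_out a b f x : bumpfun a b f -> x <= a \/ b <= x -> f x = 0.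
Proof.
move=> [/smooth1_continuous cf f0]; rewrite !le_eqVlt => -[/predU1P[->|xa]|/predU1P[<-|bx]].
- rewrite -(cvg_lim (@Rhausdorff R) (cvg_at_left_filter (cf a))).
  apply: cvg_lim; [exact: Rhausdorff|apply: cvg_near_cst].
  by near=> t; apply: f0; left; near: t; exact: nbhs_left_lt.
- by apply: f0; left.
- rewrite -(cvg_lim (@Rhausdorff R) (cvg_at_right_filter (cf b))).
  apply: cvg_lim; [exact: Rhausdorff|apply: cvg_near_cst].
  by near=> t; apply: f0; right; near: t; exact: nbhs_right_gt.
- by apply: f0; right.
Unshelve. all: by end_near. Qed.

Lemma bumpB a b c f g : bumpfun a b f -> bumpfun a b g -> bumpfun a b (fun x => f x - c * g x).
Proof.
move=> [sf f0] [sg g0]; split=> [|x xab]; last by rewrite f0// g0// mulr0 subr0.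
rewrite (_ : (fun _ => _) = f + (cst (- c) * g)); last first.
  by apply/funext => x; rewrite -mulNr.
apply: smooth1D; first exact: sf.
by apply: smooth1M; [exact: smooth1_cst|exact: sg].
Qed.

Lemma patch_itv_id a b f : (forall x, x < a \/ b < x -> f x = 0) -> f \_ `[a, b] = f.
Proof.
move=> f0; apply/funext => x; rewrite patchE; case: ifPn => // /negP.
rewrite inE/= in_itv/= => /negP; rewrite negb_and -!ltNge => /orP[] h.
- by rewrite f0//; left.
- by rewrite f0//; right.
Qed.

Lemma continuous_itv_integrable a b f : continuous f ->
  (forall x, x < a \/ b < x -> f x = 0) -> lambda.-integrable setT (EFin \o f).
Proof.
move=> cf f0; rewrite -(patch_itv_id f0) -restrict_EFin.
apply/integrable_restrict => //; rewrite setTI.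
apply: continuous_compact_integrable; first exact: segment_compact.
exact: continuous_subspaceT.
Qed.

Lemma bump_integrable a b f : bumpfun a b f -> lambda.-integrable setT (EFin \o f).
Proof. by move=> [/smooth1_continuous cf f0]; exact: (@continuous_itv_integrable a b f). Qed.

Lemma integral_derive_eq0 a b f (df : R -> R) :
  (forall x, is_derive x (1:R) f (df x)) -> continuous df ->
  (forall x, x < a \/ b < x -> f x = 0) ->
  (\int[lambda]_x (df x)%:E = 0)%E.
Proof.
move=> dfP cdf f0.
have df0 x : x < a \/ b < x -> df x = 0.
  move=> xab; have /@derive_val <- := dfP x.
  rewrite -[RHS](derive_cst (0 : R) x (1 : R)); apply: near_eq_derive => /=.
  case: xab => [xa|bx].
  - by near=> y; apply: f0; left; near: y; exact: lt_nbhsl.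
  - by near=> y; apply: f0; right; near: y; exact: lt_nbhsr.
have cf : continuous f.
  by move=> x; apply/differentiable_continuous/derivable1_diffP; have [] := dfP x.
(* Both points lie strictly outside the support, so f vanishes at them; min and max ensure A < B
   even when b < a. *)
pose A := Num.min a b - 1; pose B := Num.max a b + 1.
have Aa : A < a by rewrite /A ltrBlDr gt_min ltrDl ltr01.
have bB : b < B by rewrite /B ltr_pwDr// le_max lexx orbT.
have AB : A < B by rewrite (lt_trans Aa)// /B ltr_pwDr// le_max lexx.
have -> : (fun x => (df x)%:E) = (EFin \o df) \_ `[A, B].
  rewrite restrict_EFin patch_itv_id// => x [xA|Bx]; apply: df0.
    by left; exact: lt_trans Aa.
  by right; exact: lt_trans Bx.
rewrite -integral_mkcond/= (@continuous_FTC2 _ df f)//.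
- by rewrite !f0 ?subee//; [left|right].
- exact: continuous_subspaceT.
- split.
  + by move=> x _; have [] := dfP x.
  + exact/cvg_at_right_filter/cf.
  + exact/cvg_at_left_filter/cf.
- by move=> x _; rewrite derive1E; have /@derive_val := dfP x.
Unshelve. all: by end_near. Qed.

(** The primitive from -oo vanishes to the left of a because f does, and to the right of b because
    the total integral is zero. *)
Lemma bump_primitive a b f : bumpfun a b f -> \int[lambda]_x f x = 0 ->
  exists2 F, bumpfun a b F & derive1 F = f.
Proof.
move=> bf If; have [sf f0] := bf; have fi := bump_integrable bf.
pose F x := \int[lambda]_(t in [set` Interval -oo%O (BRight x)]) f t.
have FP x : derivable F x 1 /\ derive1 F x = f x.
  apply: (@continuous_FTC1 _ f -oo%O x (x + 1)); rewrite ?ltrDl ?bnd_simp//.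
    exact: integrableS fi.
- exact: ltNyr.
- exact: smooth1_continuous.
have F'f : derive1 F = f by apply/funext => x; have [] := FP x.
exists F => //; split=> [|x xab].
  by apply: smooth1_of_derive; [move=> x; have [] := FP x|rewrite F'f].
rewrite /F; case: xab => [xa|bx].
  rewrite (eq_Rintegral _ (g := cst 0)) ?Rintegral_cst ?mul0r// => y.
  rewrite inE/= in_itv/= => yx; apply: f0; left; exact: le_lt_trans xa.
rewrite Rintegral_mkcond -[RHS]If; apply: eq_Rintegral => y _.
rewrite patchE; case: ifPn => // /negP; rewrite inE/= in_itv/= => /negP.
by rewrite -ltNge => xy; rewrite f0//; right; exact: lt_trans xy.
Qed.

(** The arguments are m (x - a) and m (b - x) with m = k + 1, expanded to fit [smooth1_affine]. The
    shift keeps m positive at k = 0, whose bump later serves as the fixed profile [rho]. *)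
Definition itv_bump (k : nat) a b : R -> R := fun x =>
  flat 1 (k.+1%:R * x + (- (k.+1%:R * a))) * flat 1 ((- k.+1%:R) * x + k.+1%:R * b).

Lemma flat1_gt0 x : 0 < x -> flat 1 x = expR (- x^-1) :> R.
Proof. by move=> x0; rewrite /flat x0 hornerE mul1r. Qed.

Lemma flat1_le0 x : x <= 0 -> flat 1 x = 0 :> R.
Proof. by move=> x0; rewrite /flat ltNge x0. Qed.

Lemma flat1_itv x : 0 <= flat 1 x <= 1.
Proof.
have [x0|x0] := leP x 0; first by rewrite flat1_le0// lexx ler01.
by rewrite flat1_gt0// expR_ge0/= expR_le1 oppr_le0 invr_ge0 ltW.
Qed.

Lemma bump_itv_bump k a b : bumpfun a b (itv_bump k a b).
Proof.
split=> [|x xab].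
  by apply: smooth1M; apply: smooth1_affine; exact: smooth1_flat.
rewrite /itv_bump; case: xab => [xa|bx].
  by rewrite flat1_le0 ?mul0r// -mulrBr pmulr_rle0// subr_le0 ltW.
by rewrite [X in _ * X]flat1_le0 ?mulr0// mulNr addrC -mulrBr pmulr_rle0// subr_le0 ltW.
Qed.

Lemma itv_bump_itv k a b x : 0 <= itv_bump k a b x <= 1.
Proof.
have /andP[h0 h1] := flat1_itv (k.+1%:R * x + (- (k.+1%:R * a))).
have /andP[g0 g1] := flat1_itv ((- k.+1%:R) * x + k.+1%:R * b).
by rewrite /itv_bump mulr_ge0//= mulr_ile1.
Qed.

Lemma itv_bump_eq0 k a b x : x <= a \/ b <= x -> itv_bump k a b x = 0.
Proof.
rewrite /itv_bump => -[xa|bx].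
  by rewrite flat1_le0 ?mul0r// -mulrBr pmulr_rle0// subr_le0.
by rewrite [X in _ * X]flat1_le0 ?mulr0// mulNr addrC -mulrBr pmulr_rle0// subr_le0.
Qed.

Lemma cvg_flat1 x : 0 < x -> (fun k => flat 1 (k.+1%:R * x)) @ \oo --> (1 : R).
Proof.
move=> x0; rewrite (_ : (fun k => _) = (fun k => expR (- (x^-1 * harmonic k)))).
  rewrite -[X in _ --> X]expR0; apply: continuous_cvg; first exact: continuous_expR.
  rewrite -[X in _ --> X]oppr0; apply: cvgN.
  rewrite -[X in _ --> X](mulr0 x^-1); apply: cvgM; first exact: cvg_cst.
  exact: cvg_harmonic.
by apply/funext => k; rewrite flat1_gt0 ?mulr_gt0// invfM mulrC.
Qed.

Lemma cvg_itv_bump a b x :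
  (fun k => itv_bump k a b x) @ \oo --> (\1_`]a, b[%classic x : R).
Proof.
rewrite indicE; have [|/negP] := boolP (x \in `]a, b[%classic).
  rewrite inE/= in_itv/= => /andP[ax xb].
  rewrite -[X in _ --> X]mulr1; apply: cvgM.
    under eq_fun do rewrite -mulrBr.
    by apply: cvg_flat1; rewrite subr_gt0.
  under eq_fun do rewrite mulNr addrC -mulrBr.
  by apply: cvg_flat1; rewrite subr_gt0.
rewrite inE/= in_itv/= => /negP; rewrite negb_and -!leNgt => /orP h.
rewrite (_ : (fun k => _) = cst 0); first exact: cvg_cst.
by apply/funext => k; rewrite itv_bump_eq0.
Qed.

End bump_functions.

(** * Boxes of R^n *)

Section box.
Context {R : realType} {n : nat}.
Implicit Types (a b c d x : 'rV[R]_n).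

Definition box a b := [set x : 'rV[R]_n | forall i, x 0 i \in `]a 0 i, b 0 i[].
Definition cbox a b := [set x : 'rV[R]_n | forall i, x 0 i \in `[a 0 i, b 0 i]].

Lemma box_sub_cbox a b : box a b `<=` cbox a b.
Proof. by move=> x h i; exact: subset_itv_oo_cc (h i). Qed.

Lemma compact_cbox a b : compact (cbox a b).
Proof.
exact: (@rV_compact R n (fun i => [set` `[a 0 i, b 0 i]])
  (fun i => @segment_compact R (a 0 i) (b 0 i))).
Qed.

Lemma open_box a b : open (box a b).
Proof.
have -> : box a b = \big[setI/setT]_(i < n) ((fun x => x 0 i) @^-1` `]a 0 i, b 0 i[%classic).
  rewrite -bigcap_seq; apply/seteqP; split=> x /= h i; first by move=> _; exact: h.
  by apply: h; rewrite /= mem_index_enum.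
elim/big_ind : _ => [|A B oA oB|i _]; [exact: openT|exact: openI|].
apply: open_comp; last exact: itv_open.
by move=> x _; exact: coord_continuous.
Qed.

Lemma setI_box a b c d : box a b `&` box c d =
  box (\row_i Num.max (a 0 i) (c 0 i)) (\row_i Num.min (b 0 i) (d 0 i)).
Proof.
apply/seteqP; split=> x /=.
  move=> [h k] i; rewrite in_itv/= !mxE gt_max lt_min.
  by have := h i; have := k i; rewrite !in_itv/= => /andP[-> ->] /andP[-> ->].
move=> h; split=> i; have := h i; rewrite !in_itv/= !mxE gt_max lt_min.
  by move=> /andP[/andP[-> _] /andP[-> _]].
by move=> /andP[/andP[_ ->] /andP[_ ->]].
Qed.

Definition ratr_row (q : 'rV[rat]_n) : 'rV[R]_n := map_mx ratr q.

(** Rational boxes form a countable base. Having the closed box inside U makes the bumps of the open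
    box test functions on U, and countability lets almost everywhere statements be glued. *)
Lemma open_rat_box (U : set 'rV[R]_n) x : open U -> U x ->
  exists q : 'rV[rat]_n * 'rV[rat]_n,
    box (ratr_row q.1) (ratr_row q.2) x /\
    cbox (ratr_row q.1) (ratr_row q.2) `<=` U.
Proof.
move=> oU Ux; have /nbhs_ballP[e /= e0 eU] : nbhs x U by exact: open_nbhs_nbhs.
have lo i : exists q : rat, ratr q \in `]x 0 i - e, x 0 i[.
  by apply: rat_in_itvoo; rewrite ltrBlDr ltrDl.
have hi i : exists q : rat, ratr q \in `]x 0 i, x 0 i + e[.
  by apply: rat_in_itvoo; rewrite ltrDl.
exists (\row_i sval (cid (lo i)), \row_i sval (cid (hi i))); split=> /=.
  move=> i; rewrite in_itv/= !mxE; case: cid => /= p; rewrite in_itv/= => /andP[_ ->].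
  by case: cid => /= q; rewrite in_itv/= => /andP[-> _].
move=> y yb; apply: eU; split=> // i j; rewrite (ord1 i); have := yb j.
rewrite in_itv/= !mxE; case: cid => /= p; rewrite in_itv/= => /andP[pe _].
case: cid => /= q; rewrite in_itv/= => /andP[_ qe] /andP[py yq].
rewrite /ball/= ltr_distlC; apply/andP; split.
- exact: lt_le_trans pe py.
- exact: le_lt_trans yq qe.
Qed.

Lemma open_bigcup_rat_box (U : set 'rV[R]_n) : open U ->
  U = \bigcup_(q in [set q : 'rV[rat]_n * 'rV[rat]_n |
        cbox (ratr_row q.1) (ratr_row q.2) `<=` U]) box (ratr_row q.1) (ratr_row q.2).
Proof.
move=> oU; apply/seteqP; split=> x.
  by move=> /(open_rat_box oU)[q [qx qU]]; exists q.
by move=> [q qU /box_sub_cbox]; exact: qU.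
Qed.

Lemma measurable_box a b : measurable (box a b).
Proof.
rewrite (_ : box a b =
    \bigcap_(i in [set: 'I_n]) (@rV_coord R n i @^-1` `]a 0 i, b 0 i[%classic)); last first.
  apply/seteqP; split=> x h i; first by move=> _; exact: h.
  exact: (h i Logic.I).
apply: fin_bigcap_measurable => // i _.
by rewrite -[X in measurable X]setTI; exact: measurable_rV_coord.
Qed.

(** The sigma-algebra is generated by the coordinates and not by the topology; an open set belongs
    to it as a countable union of rational boxes. *)
Lemma open_measurable_rV (U : set 'rV[R]_n) : open U -> measurable U.
Proof.
move=> /open_bigcup_rat_box ->; rewrite bigcup_mkcond; apply: countable_bigcupT_measurable => // q.
by case: ifPn => // _; exact: measurable_box.
Qed.

End box.

Section box_measure.
Context {R : realType} {n : nat}.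
Implicit Types (a b c d x : 'rV[R]_n).

Lemma continuous_measurable_rV (f : 'rV[R]_n -> R) :
  continuous f -> measurable_fun setT f.
Proof.
move=> /continuousP cf; apply: (measurability _ (measurable_realfun.RGenOpens.measurableE R)).
move=> _ [_ [a [b ->] <-]]; rewrite setTI; apply: open_measurable_rV.
exact/cf/interval_open.
Qed.

Definition boxes : set (set 'rV[R]_n) := [set B | exists a b, B = box a b].

(** The preimage of an open interval under a coordinate is open, hence a countable union of rational
    boxes. The boxes, stable under intersection, can thus feed Dynkin's theorem. *)
Lemma measurable_rV_sub_boxes : @measurable _ 'rV[R]_n `<=` <<s boxes >>.
Proof.
have mbox (q : 'rV[rat]_n * 'rV[rat]_n) :
    @measurable _ (g_sigma_algebraType boxes) (box (ratr_row q.1) (ratr_row q.2)).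
  by apply: sub_sigma_algebra; eexists; eexists.
have mcoord i : measurable_fun setT (fun x : g_sigma_algebraType boxes => (x : 'rV[R]_n) 0 i).
  apply: (measurability _ (measurable_realfun.RGenOpens.measurableE R)).
  move=> _ [_ [a [b ->] <-]]; rewrite setTI.
  have /open_bigcup_rat_box -> : open ((fun x : 'rV[R]_n => x 0 i) @^-1` `]a, b[%classic).
    apply: open_comp; last exact: interval_open.
    by move=> x _; exact: coord_continuous.
  rewrite bigcup_mkcond; apply: countable_bigcupT_measurable => // q.
  by case: ifPn.
apply: smallest_sub; first exact: smallest_sigma_algebra.
move=> A; rewrite -bigcup_seq/= => -[i _ [B mB <-]].
exact: (mcoord i measurableT B mB).
Qed.

Lemma leb_cbox_lty a b : (leb n (cbox a b) < +oo)%E.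
Proof.
rewrite (leb_box (A := fun i => `[a 0 i, b 0 i]%classic))//.
rewrite ltey_eq; apply/orP; left.
elim/big_ind : _ => // [x y|i _]; first exact: fin_numM.
by rewrite lebesgue_measure_itv; case: ifPn.
Qed.

Lemma measurable_cbox a b : measurable (cbox a b).
Proof.
rewrite (_ : cbox a b =
    \bigcap_(i in [set: 'I_n]) (@rV_coord R n i @^-1` `[a 0 i, b 0 i]%classic)); last first.
  apply/seteqP; split=> x h i; first by move=> _; exact: h.
  exact: (h i Logic.I).
apply: fin_bigcap_measurable => // i _.
by rewrite -[X in measurable X]setTI; exact: measurable_rV_coord.
Qed.

Lemma leb_box_lty a b : (leb n (box a b) < +oo)%E.
Proof.
apply: le_lt_trans (leb_cbox_lty a b); apply: le_measure; rewrite ?inE.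
- exact: measurable_box.
- exact: measurable_cbox.
- exact: box_sub_cbox.
Qed.

Lemma leb_box_gt0 a b x : box a b x -> (0 < leb n (box a b))%E.
Proof.
move=> bx; rewrite (leb_box (A := fun i => `]a 0 i, b 0 i[%classic))//.
elim/big_ind : _ => [|y z y0 z0|i _]; [exact: lte01|exact: mule_gt0|].
have := bx i; rewrite in_itv/= => /andP[ax xb].
by rewrite lebesgue_measure_itv/= lte_fin (lt_trans ax xb) -EFinB lte_fin subr_gt0 (lt_trans ax xb).
Qed.

Lemma leb_open_gt0 (U : set 'rV[R]_n) x : open U -> U x -> (0 < leb n U)%E.
Proof.
move=> oU /(open_rat_box oU)[q [qx qU]]; apply: lt_le_trans (leb_box_gt0 qx) _.
apply: le_measure; rewrite ?inE; [exact: measurable_box|exact: open_measurable_rV|].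
exact: subset_trans (@box_sub_cbox _ _ _ _) qU.
Qed.

Definition tensor (phi : 'I_n -> R -> R) (x : 'rV[R]_n) : R := \prod_i phi i (x 0 i).

Lemma tensor_continuous phi : (forall i, continuous (phi i)) -> continuous (tensor phi).
Proof.
move=> cphi; apply: continuous_big; first exact: mul_continuous.
move=> i _ x; apply: continuous_comp; [exact: coord_continuous|exact: cphi].
Qed.

Lemma continuous_box_bounded (f : 'rV[R]_n -> R) a b : continuous f ->
  (forall x, ~ cbox a b x -> f x = 0) -> exists M, forall x, `|f x| <= M.
Proof.
move=> cf f0; have /compact_bounded[M [Mr HM]] : compact (f @` cbox a b).
  apply: continuous_compact; last exact: compact_cbox.
  exact: continuous_subspaceT.
exists (Num.max 0 (M + 1)) => x; rewrite le_max.
have [xab|/f0 ->] := pselect (cbox a b x); last by rewrite normr0 lexx.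
have M1 : M < M + 1 by rewrite ltrDl.
by apply/orP; right; apply: (HM _ M1); exists x.
Qed.

Lemma integrable_mul_bounded (D : set 'rV[R]_n) (h g : 'rV[R]_n -> R) M :
  measurable D -> (leb n).-integrable D (EFin \o h) -> measurable_fun D g ->
  (forall x, `|g x| <= M) -> (leb n).-integrable D (fun x => (h x * g x)%:E).
Proof.
move=> mD ih mg gM.
rewrite (_ : (fun x => _) = ((EFin \o h) \* (EFin \o g))%E); last first.
  by apply/funext => x /=; rewrite EFinM.
apply: integrableMl => //; exists M; split; first exact: num_real.
by move=> y My x _ /=; rewrite (le_trans (gM x))// ltW.
Qed.

Lemma tensor_out phi a b x : (forall i, bumpfun (a 0 i) (b 0 i) (phi i)) ->
  ~ box a b x -> tensor phi x = 0.
Proof.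
move=> bphi /existsNP[i /negP]; rewrite in_itv/= negb_and -!leNgt => /orP xi.
by rewrite /tensor (bigD1 i)//= (bump_out (bphi i)) ?mul0r.
Qed.

Lemma tensor_bounded phi a b : (forall i, bumpfun (a 0 i) (b 0 i) (phi i)) ->
  exists M, forall x, `|tensor phi x| <= M.
Proof.
move=> bphi; apply: (@continuous_box_bounded _ a b).
  by apply: tensor_continuous => i; apply: smooth1_continuous; case: (bphi i).
by move=> x xab; apply: (tensor_out bphi) => h; apply/xab/box_sub_cbox.
Qed.

End box_measure.

(** * The fundamental lemma on a box *)

Section fundamental_lemma.
Context {R : realType} {n : nat}.
Implicit Types (a b c d x : 'rV[R]_n).
Local Notation leb := (@leb R n).

Let itv_tensor c d k := tensor (fun i => itv_bump k (c 0 i) (d 0 i)).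

Let itv_tensor_itv c d k x : 0 <= itv_tensor c d k x <= 1.
Proof.
rewrite /itv_tensor /tensor; elim/big_ind : _ => [|y z /andP[y0 y1] /andP[z0 z1]|i _].
- by rewrite ler01 lexx.
- by rewrite mulr_ge0//= mulr_ile1.
- exact: itv_bump_itv.
Qed.

Let cvg_itv_tensor c d x : (fun k => itv_tensor c d k x) @ \oo --> (\1_(box c d) x : R).
Proof.
rewrite (_ : \1_(box c d) x = \prod_i (\1_`]c 0 i, d 0 i[%classic (x 0 i) : R)).
  by apply: cvg_big => [|i _]; [exact: mul_continuous|exact: cvg_itv_bump].
rewrite indicE; have [|/negP] := boolP (x \in box c d).
  rewrite inE => xcd; rewrite big1// => i _; rewrite indicE mem_set//.
  exact: xcd.
rewrite inE => /existsNP[i xi]; rewrite (bigD1 i)//= indicE memNset ?mul0r//.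
Qed.

(* The bumps exp(-1/(k(t-a))) exp(-1/(k(b-t))) converge to the indicator of ]a,b[. *)
Lemma tensor_integral_box (D : set 'rV[R]_n) h c d :
  measurable D -> leb.-integrable D (EFin \o h) ->
  (forall k, \int[leb]_(x in D) (h x * tensor (fun i => itv_bump k (c 0 i) (d 0 i)) x) = 0) ->
  (\int[leb]_(x in D `&` box c d) (h x)%:E = 0)%E.
Proof.
move=> mD ih h0.
have bt k i := bump_itv_bump k (c 0 i) (d 0 i).
have ct k : continuous (itv_tensor c d k).
  by apply: tensor_continuous => i; apply: smooth1_continuous; case: (bt k i).
have mt k : measurable_fun D (itv_tensor c d k).
  by apply: measurable_funTS; exact: continuous_measurable_rV.
have ik k : leb.-integrable D (fun x => (h x * itv_tensor c d k x)%:E).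
  apply: (@integrable_mul_bounded _ _ _ _ _ 1) => // x.
  by have /andP[t0 t1] := itv_tensor_itv c d k x; rewrite ger0_norm.
rewrite integral_mkcondr.
have [|||||_ _ H] := @dominated_convergence _ _ _ leb D mD
  (fun k x => (h x * itv_tensor c d k x)%:E) ((EFin \o h) \_ (box c d))
  (abse \o (EFin \o h)).
- by move=> k; have /integrableP[] := ik k.
- apply/measurable_restrict => //; first exact: measurable_box.
  by apply: measurable_funS (measurable_int _ ih) => //; exact: subIsetl.
- apply/aeW => x _; rewrite restrict_EFin/= patchE.
  apply: cvg_EFin; first by near=> k.
  rewrite (_ : (if _ then _ else _) = h x * \1_(box c d) x); last first.
    by rewrite indicE; case: ifPn => /= _; rewrite ?mulr1 ?mulr0.
  by apply: cvgM; [exact: cvg_cst|exact: cvg_itv_tensor].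
- exact: integrable_abse.
- apply/aeW => x k _ /=; rewrite lee_fin normrM.
  have /andP[t0 t1] := itv_tensor_itv c d k x.
  by rewrite (ger0_norm t0) ler_piMr.
(* The integrals against the bumps are all zero, and dominated convergence sends them to the
   integral over the box. *)
apply: (cvg_unique _ H) => //.
rewrite (_ : [sequence _]_k = cst 0); first exact: cvg_cst.
apply/funext => k /=; rewrite -[LHS]fineK ?integrable_fin_num//.
by have := h0 k; rewrite /Rintegral => ->.
Unshelve. all: by end_near. Qed.

(* Dynkin's theorem turns the vanishing on the boxes into the vanishing on all
   measurable sets. *)
Lemma tensor_integral_ae_eq0 a b h :
  leb.-integrable (box a b) (EFin \o h) ->
  (forall phi, (forall i, bumpfun (a 0 i) (b 0 i) (phi i)) ->
    \int[leb]_(x in box a b) (h x * tensor phi x) = 0) ->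
  ae_eq leb (box a b) (EFin \o h) (cst 0%E).
Proof.
move=> ih h0; have mab := measurable_box a b.
suff H E : measurable E -> (\int[leb]_(x in box a b `&` E) (h x)%:E = 0)%E.
  apply: integral_ae_eq => // E Eab mE; rewrite integral0.
  by rewrite -(setIidr Eab); exact: H.
have iS A : measurable A -> leb.-integrable (box a b `&` A) (EFin \o h).
  by move=> mA; apply: integrableS ih => //; exact: measurableI.
pose G := [set A : set 'rV[R]_n | measurable A /\
  (\int[leb]_(x in box a b `&` A) (h x)%:E = 0)%E].
have boxG c d : G (box c d).
  split; first exact: measurable_box.
  (* Duplicating [box a b] replaces [box c d] by its intersection with [box a b]; the bumps of this
     smaller box are bumps of [box a b], to which [h0] applies. *)
  rewrite -[box a b]setIid -setIA setI_box.
  apply: tensor_integral_box => // k; apply: h0 => i; rewrite !mxE.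
  have [s s0] := bump_itv_bump k (Num.max (a 0 i) (c 0 i)) (Num.min (b 0 i) (d 0 i)).
  split=> // x [xa|bx]; apply: s0; first by left; rewrite lt_max xa.
  by right; rewrite gt_min bx.
suff GP : <<s boxes >> `<=` G by move=> /measurable_rV_sub_boxes/GP[].
apply: lambda_system_subset => //.
- move=> _ _ [c [d ->]] [c' [d' ->]]; rewrite setI_box; eexists; eexists; reflexivity.
- apply/dynkin_lambda_system; split.
  + split=> //; rewrite setIT.
    have [_] := boxG a b; by rewrite setIid.
  + move=> A [mA A0]; split; first exact: measurableC.
    have [_] := boxG a b; rewrite setIid -{1}(setUIDK (box a b) A).
    rewrite setDE integral_setU ?A0 ?add0e//.
    * exact: measurableI.
    * by apply: measurableI => //; exact: measurableC.
    * by rewrite -setDE setUIDK; exact: measurable_int ih.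
    * by apply/disj_setPS => x [[_ ?] [_ ?]].
  + move=> F tF FG; split; first by apply: bigcup_measurable => k _; case: (FG k).
    rewrite setI_bigcupr integral_bigcup.
    * by rewrite eseries0// => k _ _; case: (FG k).
    * exact: trivIset_setIl.
    * by move=> k; apply: measurableI => //; case: (FG k).
    * rewrite -setI_bigcupr; apply: iS.
      by apply: bigcup_measurable => k _; case: (FG k).
- by move=> _ [c [d ->]]; exact: boxG.
Qed.

End fundamental_lemma.

(** * Partial derivatives and integration by parts *)

Section slice.
Context {R : realType} {n : nat}.
Implicit Types (a b x : 'rV[R]_n).

Definition slice (i : 'I_n) x (t : R) : 'rV[R]_n := \row_j if j == i then t else x 0 j.

Lemma slice_id i x : slice i x (x 0 i) = x.
Proof. by apply/rowP => j; rewrite mxE; case: eqP => // ->. Qed.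

Lemma slice_shift i x (t h : R) :
  h *: (delta_mx 0 i : 'rV[R]_n) + slice i x t = slice i x (h + t).
Proof.
apply/rowP => j; rewrite !mxE/=; case: eqP => _; first by rewrite mulr1.
by rewrite mulr0 add0r.
Qed.

(** The difference quotients of f along the i-th direction and of its slice are the same function of
    h. Derivability and derivatives therefore transfer with no differentiability assumption on f. *)
Let slice_quotient (f : 'rV[R]_n -> R) i x t :
  (fun h : R => h^-1 *: (f (h *: (delta_mx 0 i : 'rV[R]_n) + slice i x t) - f (slice i x t))) =
  (fun h : R => h^-1 *: ((f \o slice i x) (h *: (1 : R) + t) - (f \o slice i x) t)).
Proof. by apply/funext => h; rewrite slice_shift /GRing.scale/= mulr1. Qed.

Lemma pderiv_slice f i x t : pderiv i f (slice i x t) = derive1 (f \o slice i x) t.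
Proof. by rewrite derive1E /pderiv /derive slice_quotient. Qed.

Lemma derivable_slice f i x t : derivable f (slice i x t) (delta_mx 0 i : 'rV[R]_n) ->
  derivable (f \o slice i x : R -> R) t (1 : R).
Proof. by rewrite /derivable -slice_quotient. Qed.

Lemma is_derive_slice f i x t : (forall y, derivable f y (delta_mx 0 i : 'rV[R]_n)) ->
  is_derive t (1 : R) (f \o slice i x : R -> R) (pderiv i f (slice i x t)).
Proof.
move=> df; rewrite pderiv_slice derive1E; apply: derivableP.
exact: derivable_slice.
Qed.

Lemma continuous_slice i x : continuous (slice i x).
Proof.
move=> t; apply/cvg_ballP => e e0; near=> s; split=> // k j.
rewrite !mxE; case: eqP => _; last exact: ballxx.
by near: s; exact: (@nbhsx_ballx R R^o).
Unshelve. all: by end_near. Qed.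

Lemma pderiv_tensor i (phi : 'I_n -> R -> R) : (forall j, smooth1 (phi j)) ->
  pderiv i (tensor phi) = tensor (fun j => if j == i then derive1 (phi j) else phi j).
Proof.
move=> sphi; apply/funext => x; rewrite -[in LHS](slice_id i x) pderiv_slice.
pose C := \prod_(j < n | j != i) phi j (x 0 j).
rewrite (_ : tensor phi \o slice i x = (fun t => phi i t * C)); last first.
  apply/funext => t /=; rewrite /tensor (bigD1 i)//= mxE eqxx; congr (_ * _).
  by apply: eq_bigr => j /negbTE ji; rewrite mxE ji.
rewrite derive1Mr; last exact: smooth1_derivable.
rewrite /tensor (bigD1 i)//= eqxx; congr (_ * _).
by apply: eq_bigr => j /negbTE ->.
Qed.

Lemma differentiable_tensor (phi : 'I_n -> R -> R) x : (forall j, smooth1 (phi j)) ->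
  differentiable (tensor phi) x.
Proof.
(* The induction runs over arbitrary lists of coordinates; [tensor phi] is the case of the full
   enumeration. *)
move=> sphi; pose T s := fun y : 'rV[R]_n => \prod_(i <- s) phi i (y 0 i).
suff : forall s, differentiable (T s) x by apply.
elim=> [|i s IHs].
  have -> : T [::] = cst 1 by apply/funext => y; rewrite /T big_nil.
  exact: differentiable_cst.
have -> : T (i :: s) = (phi i \o (fun y : 'rV[R]_n => y 0 i)) * T s.
  by apply/funext => y; rewrite /T big_cons.
apply: differentiableM => //; apply: differentiable_comp.
  exact: differentiable_coord.
exact/derivable1_diffP/smooth1_derivable.
Qed.

Lemma smooth_tensor (phi : 'I_n -> R -> R) : (forall j, smooth1 (phi j)) ->
  smooth (tensor phi).
Proof.
move=> sphi s x.
suff [psi spsi ->] : exists2 psi, (forall j, smooth1 (psi j)) &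
    foldr pderiv (tensor phi) s = tensor psi by exact: differentiable_tensor.
elim: s => [|i s [psi spsi /= ->]]; first by exists phi.
exists (fun j => if j == i then derive1 (psi j) else psi j); last exact: pderiv_tensor.
by move=> j; case: ifP => // _; exact: smooth1_derive.
Qed.

Lemma test_function_tensor (Omega : set 'rV[R]_n) a b (phi : 'I_n -> R -> R) :
  cbox a b `<=` Omega -> (forall i, bumpfun (a 0 i) (b 0 i) (phi i)) ->
  test_function Omega (tensor phi).
Proof.
move=> abO bphi; split; first by apply: smooth_tensor => i; case: (bphi i).
exists (cbox a b); split=> //; first exact: compact_cbox.
by move=> x xab; apply: (tensor_out bphi) => h; apply/xab/box_sub_cbox.
Qed.

Lemma pderiv_tensor_out i a b (phi : 'I_n -> R -> R) x :
  (forall i, bumpfun (a 0 i) (b 0 i) (phi i)) ->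
  ~ box a b x -> pderiv i (tensor phi) x = 0.
Proof.
move=> bphi; rewrite pderiv_tensor => [|j]; last by case: (bphi j).
by apply: tensor_out => j; case: ifP => // _; exact: bump_derive.
Qed.

Lemma continuous_box_integrable (G : 'rV[R]_n -> R) a b : continuous G ->
  (forall x, ~ cbox a b x -> G x = 0) -> (leb n).-integrable setT (EFin \o G).
Proof.
move=> cG G0; have [M HM] := continuous_box_bounded cG G0.
rewrite (_ : EFin \o G = (EFin \o G) \_ (cbox a b)); last first.
  apply/funext => x; rewrite patchE; case: ifPn => // /negP.
  by rewrite inE => /G0 /= ->.
have mab := measurable_cbox a b.
apply/integrable_restrict => //; rewrite setTI.
apply: measurable_bounded_integrable => //.
- exact: leb_cbox_lty.
- by apply: measurable_funTS; exact: continuous_measurable_rV.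
- exists M; split; first exact: num_real.
  by move=> y My x _ /=; rewrite (le_trans (HM x))// ltW.
Qed.

End slice.

(** Fubini, by induction on the dimension, as [leb] splits off the first coordinate. If i is that
    coordinate, it is integrated first; otherwise the induction hypothesis handles the sections at
    fixed first coordinate. *)
Lemma integral_slice_eq0 (R : realType) n (i : 'I_n) (G : 'rV[R]_n -> R) :
  (leb n).-integrable setT (EFin \o G) ->
  (forall x, \int[lebesgue_measure]_t (G (slice i x t))%:E = 0)%E ->
  (\int[leb n]_x (G x)%:E = 0)%E.
Proof.
elim: n => [|n IHn] in i G *; first by case: i.
move=> iG sG; have mG := measurable_int _ iG.
have iGc : (lebesgue_measure \x leb n)%E.-integrable setT (EFin \o (G \o @rV_cons R n)).
  apply/integrableP; split.
    by rewrite compA; apply: measurableT_comp mG (@measurable_rV_cons R n).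
  move/integrableP : iG => [_]; apply: le_lt_trans.
  rewrite [in leRHS]/= /leb_step ge0_integral_pushforward//.
  - exact: measurable_rV_cons.
  - rewrite -[X in measurable_fun _ X]/(abse \o (EFin \o G)).
    exact: measurableT_comp.
have -> : (\int[leb n.+1]_x (G x)%:E =
    \int[(lebesgue_measure \x leb n)%E]_z (G (rV_cons z))%:E)%E.
  exact: (@integral_pushforward _ _ _ _ _ _ (@measurable_rV_cons R n) _ setT _ mG iGc).
case: (unliftP ord0 i) => [j ij|i0].
- rewrite -(integral12_prod_meas1 iGc) -[RHS](@integral0 _ _ _ lebesgue_measure setT).
  apply: ae_eq_integral => //; first exact: (measurable_fubini_F iGc).
  (* The section at t is known to be integrable only for almost every t, which suffices for the
     outer integral. *)
  apply: filterS (ae_integrable1 iGc) => t it _.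
  rewrite /fubini_F/=; apply: (IHn j) => // y; rewrite -[RHS](sG (rV_cons (t, y))).
  apply: eq_integral => s _; congr (G _)%:E; apply/rowP => k; rewrite !mxE ij.
  case: unliftP => [l ->|->]; first by rewrite (inj_eq lift_inj) mxE.
  by rewrite (negbTE (neq_lift _ _)).
- rewrite -(integral21_prod_meas1 iGc) -[RHS](@integral0 _ _ _ (leb n) setT).
  apply: eq_integral => y _.
  (* The 0 is a dummy value: slicing along the first coordinate overwrites it. *)
  rewrite /fubini_G/= -[RHS](sG (rV_cons (0, y))) i0.
  apply: eq_integral => s _; congr (G _)%:E; apply/rowP => k; rewrite !mxE.
  by case: unliftP => [l ->|->]; rewrite ?eqxx// eq_sym (negbTE (neq_lift _ _)).
Qed.

Section parts.
Context {R : realType} {n : nat}.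
Implicit Types (a b x : 'rV[R]_n).

(** On each line in direction i the fundamental theorem of calculus gives zero, since F vanishes
    outside the box; Fubini concludes. *)
Lemma integral_pderiv_eq0 (F : 'rV[R]_n -> R) i a b :
  (forall x, derivable F x (delta_mx 0 i : 'rV[R]_n)) -> continuous (pderiv i F) ->
  (forall x, ~ cbox a b x -> F x = 0) ->
  (forall x, ~ cbox a b x -> pderiv i F x = 0) ->
  (\int[leb n]_x (pderiv i F x)%:E = 0)%E.
Proof.
move=> dF cF F0 dF0; apply: (@integral_slice_eq0 _ _ i).
  exact: continuous_box_integrable dF0.
move=> x; apply: (@integral_derive_eq0 _ (a 0 i) (b 0 i) (F \o slice i x)).
- by move=> t; exact: is_derive_slice.
- by move=> t; apply: continuous_comp; [exact: continuous_slice|exact: cF].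
- move=> t tab; apply: F0 => /(_ i); rewrite mxE eqxx in_itv/=.
  by case: tab => [ta|bt]; rewrite leNgt ?ta// [t <= _]leNgt bt andbF.
Qed.

(** [foldr] applies the last element of the list first, so differentiating [psi] along i beforehand
    amounts to appending i to the list. *)
Lemma smooth_pderiv i (psi : 'rV[R]_n -> R) : smooth psi -> smooth (pderiv i psi).
Proof. by move=> spsi s x; have := spsi (rcons s i) x; rewrite -cats1 foldr_cat. Qed.

Lemma smooth_continuous (psi : 'rV[R]_n -> R) : smooth psi -> continuous psi.
Proof. by move=> spsi x; exact: differentiable_continuous (spsi [::] x). Qed.

(** The product of [tensor phi] and [psi] vanishes off the box whatever [psi] does there, so its
    partial derivative integrates to zero; the product rule splits that integral. *)
Lemma tensor_integration_by_parts (Omega : set 'rV[R]_n) i a b phi psi :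
  measurable Omega -> cbox a b `<=` Omega ->
  (forall i, bumpfun (a 0 i) (b 0 i) (phi i)) -> smooth psi ->
  \int[leb n]_(x in Omega) (tensor phi x * pderiv i psi x) =
  - \int[leb n]_(x in Omega) (pderiv i (tensor phi) x * psi x).
Proof.
move=> mO abO bphi spsi.
have sphi : smooth (tensor phi) by apply: smooth_tensor => j; case: (bphi j).
have t0 x : ~ cbox a b x -> tensor phi x = 0.
  by move=> xab; apply: (tensor_out bphi) => h; apply/xab/box_sub_cbox.
have dt0 x : ~ cbox a b x -> pderiv i (tensor phi) x = 0.
  by move=> xab; apply: (@pderiv_tensor_out _ _ i a b phi x bphi) => h; apply/xab/box_sub_cbox.
have dd (w : 'rV[R]_n -> R) x : smooth w -> derivable w x (delta_mx 0 i : 'rV[R]_n).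
  by move=> sw; apply: diff_derivable; exact: (sw [::]).
have [cphi cpsi] := (smooth_continuous sphi, smooth_continuous spsi).
have cdphi := smooth_continuous (smooth_pderiv i sphi).
have cdpsi := smooth_continuous (smooth_pderiv i spsi).
have pM : pderiv i (tensor phi * psi) =
    (fun x => tensor phi x * pderiv i psi x + pderiv i (tensor phi) x * psi x).
  apply/funext => x; rewrite /pderiv deriveM; [|exact: dd|exact: dd].
  by rewrite /GRing.scale/= [psi x * _]mulrC.
have c1 : continuous (fun x => tensor phi x * pderiv i psi x).
  by move=> x; apply: continuousM; [exact: cphi|exact: cdpsi].
have c2 : continuous (fun x => pderiv i (tensor phi) x * psi x).
  by move=> x; apply: continuousM; [exact: cdphi|exact: cpsi].
have z1 x : ~ cbox a b x -> tensor phi x * pderiv i psi x = 0.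
  by move=> /t0 ->; rewrite mul0r.
have z2 x : ~ cbox a b x -> pderiv i (tensor phi) x * psi x = 0.
  by move=> /dt0 ->; rewrite mul0r.
(* Each integrand vanishes off [cbox a b], which lies in [Omega], so integrals over [Omega] become
   integrals over the whole space. *)
have restrO (G : 'rV[R]_n -> R) : (forall x, ~ cbox a b x -> G x = 0) ->
    \int[leb n]_(x in Omega) G x = \int[leb n]_x G x.
  move=> G0; rewrite Rintegral_mkcond; congr (Rintegral _ _ _).
  apply/funext => x; rewrite patchE; case: ifPn => // /negP; rewrite inE => Ox.
  by rewrite G0// => /abO.
rewrite !restrO//; apply/eqP; rewrite -addr_eq0 -RintegralD//.
- rewrite /Rintegral; have := @integral_pderiv_eq0 (tensor phi * psi) i a b.
  rewrite pM => -> //.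
  + by move=> x; apply: derivableM; exact: dd.
  + by move=> x; exact: (continuousD (c1 x) (c2 x)).
  + by move=> x /t0 E; rewrite /GRing.mul/= E mul0r.
  + by move=> x xab; rewrite z1// z2// addr0.
- exact: continuous_box_integrable z1.
- exact: continuous_box_integrable z2.
Qed.

End parts.

(** A nonnegative function with zero integral vanishes almost everywhere, which positivity on a set
    of positive measure forbids. *)
Lemma integral_gt0 d (T : measurableType d) (R : realType)
    (m : {measure set T -> \bar R}) (D : set T) (f : T -> R) :
  measurable D -> (0 < m D)%E -> m.-integrable D (EFin \o f) ->
  (forall x, D x -> 0 < f x) -> 0 < \int[m]_(x in D) f x.
Proof.
move=> mD D0 fi f0; rewrite lt_def Rintegral_ge0 ?andbT => [|x Dx]; last exact/ltW/f0.
apply/eqP => If; move: D0; rewrite lt_neqAle => /andP[/eqP + _]; apply.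
have If0 : (\int[m]_(x in D) `|(EFin \o f) x| = 0)%E.
  rewrite -[RHS]/(0%:E) -If fineK ?integrable_fin_num//.
  by apply: eq_integral => x /[!inE] Dx; rewrite gee0_abs//= lee_fin ltW// f0.
have /ae_eq_integral_abs : measurable_fun D (EFin \o f) by exact: measurable_int fi.
move=> /(_ m mD)[/(_ If0) fae _].
apply/esym/measure_negligible => //; apply: negligibleS fae => x Dx /=.
by move=> /(_ Dx)[] f00; have := f0 x Dx; rewrite f00 ltxx.
Qed.

Lemma integrable_cst_lty d (T : measurableType d) (R : realType)
    (m : {measure set T -> \bar R}) (D : set T) (c : R) :
  measurable D -> (m D < +oo)%E -> m.-integrable D (EFin \o cst c).
Proof.
move=> mD Doo; apply: measurable_bounded_integrable => //.
exists `|c|; split; first exact: num_real.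
by move=> y yc x _ /=; exact: ltW.
Qed.

(** * Functions with vanishing weak gradient on a box *)

Section weakly_constant.
Context {R : realType} {n : nat}.
Variables (a b : 'rV[R]_n) (x0 : 'rV[R]_n).
Hypothesis abx0 : box a b x0.
Local Notation leb := (@leb R n).
Local Notation lambda := (@lebesgue_measure R).
Local Notation bumps := (fun phi : 'I_n -> R -> R => forall i, bumpfun (a 0 i) (b 0 i) (phi i)).

Definition upd (phi : 'I_n -> R -> R) i f j := if j == i then f else phi j.

Lemma bumps_upd phi i f : bumps phi -> bumpfun (a 0 i) (b 0 i) f -> bumps (upd phi i f).
Proof. by move=> bphi bf j; rewrite /upd; case: eqP => // ->. Qed.

Lemma tensor_upd phi i f x :
  tensor (upd phi i f) x = f (x 0 i) * \prod_(j < n | j != i) phi j (x 0 j).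
Proof.
rewrite /tensor (bigD1 i)//= /upd eqxx; congr (_ * _).
by apply: eq_bigr => j /negbTE ->.
Qed.

Lemma tensor_integrable (w : 'rV[R]_n -> R) phi : leb.-integrable (box a b) (EFin \o w) ->
  bumps phi -> leb.-integrable (box a b) (fun x => (w x * tensor phi x)%:E).
Proof.
move=> iw bphi; have [M HM] := tensor_bounded bphi.
apply: (integrable_mul_bounded (measurable_box _ _) iw _ HM).
apply: measurable_funTS; apply: continuous_measurable_rV; apply: tensor_continuous => i.
by apply: smooth1_continuous; case: (bphi i).
Qed.

(** Vanishing of the weak gradient on the box, tested against tensor bumps only. *)
Definition kills_pderiv (w : 'rV[R]_n -> R) := forall phi i, bumps phi ->
  \int[leb]_(x in box a b) (w x * pderiv i (tensor phi) x) = 0.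

Let rho i : R -> R := itv_bump 0 (a 0 i) (b 0 i).
Let brho : bumps rho. Proof. by move=> i; exact: bump_itv_bump. Qed.

Let rho_gt0 i t : t \in `]a 0 i, b 0 i[ -> 0 < rho i t.
Proof.
rewrite in_itv/= => /andP[at_ tb]; rewrite /rho /itv_bump !flat1_gt0.
- by rewrite mulr_gt0// expR_gt0.
- by rewrite mulNr addrC -mulrBr mulr_gt0// subr_gt0.
- by rewrite -mulrBr mulr_gt0// subr_gt0.
Qed.

Let int1 (f : R -> R) := \int[lambda]_t f t.
Let L (w : 'rV[R]_n -> R) phi := \int[leb]_(x in box a b) (w x * tensor phi x).

(* [int1 g *: phi i - int1 (phi i) *: g] has integral 0, hence is the derivative of a bump. *)
Lemma tensor_integral_upd w phi i g : leb.-integrable (box a b) (EFin \o w) ->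
  kills_pderiv w -> bumps phi -> bumpfun (a 0 i) (b 0 i) g -> int1 g != 0 ->
  L w phi = int1 (phi i) / int1 g * L w (upd phi i g).
Proof.
move=> iw kw bphi bg g0; set c := _ / _.
have bd := bumpB c (bphi i) bg.
have [F bF dF] : exists2 F, bumpfun (a 0 i) (b 0 i) F &
    derive1 F = (fun t => phi i t - c * g t).
  apply: bump_primitive => //.
  have ig := bump_integrable bg.
  rewrite RintegralB//; [|exact: bump_integrable (bphi i)|].
    by rewrite RintegralZl// -/(int1 g) -/(int1 (phi i)) divfK// subrr.
  rewrite (_ : _ \o _ = (fun t => c%:E * (EFin \o g) t)%E)//.
  exact: integrableZl.
(* Testing with the primitive F in slot i puts phi_i - c g in that slot after differentiation;
   linearity then splits the integral. *)
have := kw _ i (bumps_upd bphi bF).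
rewrite pderiv_tensor => [|j]; last by case: (bumps_upd bphi bF j).
rewrite (_ : (fun j => if j == i then _ else _) = upd phi i (fun t => phi i t - c * g t)); last first.
  by apply/funext => j; rewrite /upd; case: eqP => // ->; rewrite dF.
have ip := tensor_integrable iw bphi.
have iu := tensor_integrable iw (bumps_upd bphi bg).
rewrite (_ : Rintegral _ _ _ = L w phi - c * L w (upd phi i g)).
  by move/eqP; rewrite subr_eq0 => /eqP.
rewrite -RintegralZl//; [|exact: measurable_box].
rewrite -RintegralB//.
- apply: eq_Rintegral => x _; rewrite !tensor_upd.
  have -> : tensor phi x = phi i (x 0 i) * \prod_(j < n | j != i) phi j (x 0 j).
    by rewrite /tensor (bigD1 i).
  ring.
- exact: measurable_box.
- rewrite (_ : _ \o _ = (fun x => c%:E * (w x * tensor (upd phi i g) x)%:E)%E)//.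
  by apply: integrableZl => //; exact: measurable_box.
Qed.

(** The factors of phi are exchanged one at a time for those of [rho], each exchange costing a ratio
    of integrals. What remains depends on w only through [L w rho]. *)
Lemma tensor_integral_prod w phi : leb.-integrable (box a b) (EFin \o w) ->
  kills_pderiv w -> bumps phi ->
  L w phi = (\prod_i (int1 (phi i) / int1 (rho i))) * L w rho.
Proof.
move=> iw kw bphi.
(* The profile is positive inside its interval, which is nondegenerate because the box contains
   [x0]. *)
have rho0 i : int1 (rho i) != 0.
  have irho := bump_integrable (brho i).
  have rE : rho i \_ `]a 0 i, b 0 i[ = rho i.
    apply/funext => t; rewrite patchE; case: ifPn => // /negP.
    rewrite inE/= in_itv/= => /negP; rewrite negb_and -!leNgt => /orP h.
    by rewrite (bump_out (brho i)).
  rewrite /int1 -rE -Rintegral_mkcond gt_eqF//; apply: integral_gt0 => //.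
  - suff : (0 < lebesgue_measure `]a 0%R i, b 0%R i[%classic)%E by [].
    rewrite lebesgue_measure_itv/= lte_fin.
    have := abx0 i; rewrite in_itv/= => /andP[ax xb].
    by rewrite (lt_trans ax xb) -EFinB lte_fin subr_gt0 (lt_trans ax xb).
  - by apply: integrableS irho.
  - by move=> t; exact: rho_gt0.
(* [U s] is phi with the factors indexed by s already exchanged. *)
pose U (s : seq 'I_n) := fun j => if j \in s then rho j else phi j.
have bU s : bumps (U s) by move=> j; rewrite /U; case: ifP.
suff H s : uniq s -> L w phi = (\prod_(i <- s) (int1 (phi i) / int1 (rho i))) * L w (U s).
  rewrite (H _ (index_enum_uniq _)); congr (_ * L w _).
  by apply/funext => j; rewrite /U mem_index_enum.
elim: s => [_|i s IHs /= /andP[is_ us]].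
  by rewrite big_nil mul1r; congr (L w _); apply/funext.
rewrite IHs// big_cons (tensor_integral_upd iw kw (bU s) (brho i) (rho0 i)).
(* As i is not in s, slot i still holds phi_i, which gives the expected ratio. *)
rewrite /U (negbTE is_) mulrCA mulrA; congr (_ * L w _).
by apply/funext => j; rewrite /upd inE; case: eqP => [->|].
Qed.

(** Makes the product formula available for the constant 1, against which w is compared. *)
Lemma kills_pderiv_cst : kills_pderiv (cst 1).
Proof.
move=> phi i bphi.
have sphi : smooth (tensor phi) by apply: smooth_tensor => j; case: (bphi j).
under eq_Rintegral do rewrite mul1r.
rewrite Rintegral_mkcond (_ : _ \_ _ = pderiv i (tensor phi)); last first.
  apply/funext => x; rewrite patchE; case: ifPn => // /negP; rewrite inE => xab.
  by rewrite (@pderiv_tensor_out _ _ i a b phi x).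
have out x (w : 'rV[R]_n -> R) : (forall x, ~ box a b x -> w x = 0) ->
    ~ cbox a b x -> w x = 0.
  by move=> w0 xab; apply: w0 => h; apply/xab/box_sub_cbox.
rewrite /Rintegral (@integral_pderiv_eq0 _ _ _ i a b)//.
- by move=> x; apply: diff_derivable; exact: (sphi [::]).
- exact/smooth_continuous/smooth_pderiv.
- by move=> x; apply: out => {}x; exact: tensor_out.
- by move=> x; apply: out => {}x; exact: pderiv_tensor_out.
Qed.

Lemma kills_pderiv_ae_cst w : leb.-integrable (box a b) (EFin \o w) -> kills_pderiv w ->
  exists c, ae_eq leb (box a b) (EFin \o w) (cst c%:E).
Proof.
move=> iw kw; have mab := measurable_box a b.
have i1 (c : R) : leb.-integrable (box a b) (EFin \o cst c).
  by apply: integrable_cst_lty => //; exact: leb_box_lty.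
have L1 : 0 < L (cst 1) rho.
  apply: integral_gt0 => //; first exact: leb_box_gt0 abx0.
  - exact: (tensor_integrable (i1 1) brho).
  - move=> x xab; rewrite mul1r; apply: prodr_gt0 => i _; exact/rho_gt0/xab.
(* This c makes w - c integrate to zero against [rho], hence against every tensor bump, since w and
   1 obey the same product formula. *)
pose c := L w rho / L (cst 1) rho; exists c.
have iwc : leb.-integrable (box a b) (EFin \o (fun x => w x - c)).
  rewrite (_ : _ \o _ = (EFin \o w) \- (EFin \o cst c))%E; last by apply/funext.
  exact: integrableB.
have : ae_eq leb (box a b) (EFin \o (fun x => w x - c)) (cst 0%E).
  apply: tensor_integral_ae_eq0 => // phi bphi.
  transitivity (L w phi - c * L (cst 1) phi); last first.
    rewrite (tensor_integral_prod iw kw bphi).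
    rewrite (tensor_integral_prod (i1 1) kills_pderiv_cst bphi).
    by rewrite mulrCA /c divfK ?subrr// gt_eqF.
  have it1 := tensor_integrable (i1 1) bphi.
  rewrite -RintegralZl// -RintegralB//.
  - by apply: eq_Rintegral => x _; rewrite mul1r mulrBl.
  - exact: tensor_integrable.
  - rewrite (_ : _ \o _ = (fun x => c%:E * (cst 1 x * tensor phi x)%:E)%E)//.
    exact: integrableZl.
apply: filterS => x /= h /h[] /eqP; rewrite subr_eq0 => /eqP ->.
by [].
Qed.

End weakly_constant.

Lemma ae_eq_Rintegral d (T : measurableType d) (R : realType)
    (m : {measure set T -> \bar R}) (D : set T) (f g : T -> R) :
  measurable D -> measurable_fun D f -> measurable_fun D g ->
  {ae m, forall x, D x -> f x = g x} ->
  \int[m]_(x in D) f x = \int[m]_(x in D) g x.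
Proof.
move=> mD mf mg fg; congr fine; apply: ae_eq_integral => //; try exact/measurable_EFinP.
by apply: filterS fg => x h Dx; rewrite h.
Qed.

(** Indices are coded as naturals by [pickle]; naturals that code no index get the trivial
    predicate. *)
Lemma ae_forall_count d (T : measurableType d) (R : realType)
    (m : {measure set T -> \bar R}) (I : countType) (P : I -> T -> Prop) :
  (forall i, {ae m, forall x, P i x}) -> {ae m, forall x, forall i, P i x}.
Proof.
move=> aeP; pose P' k x := if @unpickle I k is Some i then P i x else True.
have : {ae m, forall x, forall k, P' k x}.
  apply: ae_foralln => k; rewrite /P'; case: unpickle => [i|]; first exact: aeP.
  exact: aeW.
by apply: filterS => x h i; have := h (pickle i); rewrite /P' pickleK.
Qed.

(** * Weak derivatives on a bounded open set *)

Section weak_derivatives.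
Context {R : realType} {n : nat}.
Variable Omega : set 'rV[R]_n.
Hypotheses (Omega_open : open Omega) (Omega_bounded : bounded_set Omega).
Local Notation leb := (@leb R n).
Implicit Types (w h : 'rV[R]_n -> R) (a b x : 'rV[R]_n).

Let mOmega : measurable Omega := open_measurable_rV Omega_open.

Lemma leb_bounded_lty : (leb Omega < +oo)%E.
Proof.
have [M [Mr HM]] := Omega_bounded.
have MM1 : M < M + 1 by rewrite ltrDl.
(* [bounded_set] bounds the norm by every number strictly above M, hence the M + 1. *)
have sub : Omega `<=` cbox (const_mx (- (M + 1))) (const_mx (M + 1)).
  move=> x Ox i; rewrite in_itv/= !mxE -ler_norml.
  apply: le_trans (HM _ MM1 _ Ox); rewrite -[leRHS]/(mx_norm x) mx_normrE.
  exact: (le_bigmax _ (fun ij => `|x ij.1 ij.2|) (0, i)).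
apply: le_lt_trans (leb_cbox_lty _ _); apply: le_measure sub; rewrite ?inE//.
exact: measurable_cbox.
Qed.

Lemma L2_measurable w : L2 Omega w -> measurable_fun Omega w.
Proof. by case. Qed.

Lemma L2_integrableM w h : L2 Omega w -> L2 Omega h ->
  leb.-integrable Omega (fun x => (w x * h x)%:E).
Proof.
move=> [mw iw] [mh ih].
apply: (le_integrable mOmega _ _ (integrableD mOmega iw ih)).
  by apply/measurable_EFinP; exact: measurable_funM.
move=> x _; rewrite -EFinD /= lee_fin [leRHS]ger0_norm ?addr_ge0 ?sqr_ge0//.
rewrite normrM -[w x ^+ 2]real_normK ?num_real// -[h x ^+ 2]real_normK ?num_real//.
have := sqr_ge0 (`|w x| - `|h x|); have := normr_ge0 (w x); have := normr_ge0 (h x).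
nra.
Qed.

Lemma L2_of_bounded w M : measurable_fun Omega w -> (forall x, `|w x| <= M) -> L2 Omega w.
Proof.
move=> mw wM; split=> //.
apply: measurable_bounded_integrable => //.
- exact: leb_bounded_lty.
- exact: measurable_funX.
- exists (M ^+ 2); split; first exact: num_real.
  move=> y My x _ /=; rewrite (le_trans _ (ltW My))// normrX.
  by rewrite lerXn2r// nnegrE ?(le_trans _ (wM x)).
Qed.

Lemma L2_integrable w : L2 Omega w -> leb.-integrable Omega (EFin \o w).
Proof.
move=> Lw; have L1 : L2 Omega (cst 1).
  by apply: (@L2_of_bounded _ 1) => // x; rewrite normr1.
have := L2_integrableM Lw L1.
by rewrite (_ : (fun x => _) = EFin \o w)//; apply/funext => x /=; rewrite mulr1.
Qed.

Lemma L2B w h : L2 Omega w -> L2 Omega h -> L2 Omega (fun x => w x - h x).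
Proof.
move=> Lw Lh; have [[mw iw] [mh ih]] := (Lw, Lh).
split; first exact: measurable_funB.
have iwh := L2_integrableM Lw Lh.
rewrite (_ : (fun x => _) = (fun x => (w x ^+ 2)%:E + (h x ^+ 2)%:E -
    ((w x * h x)%:E + (w x * h x)%:E))%E).
  by apply: integrableB => //; exact: integrableD.
by apply/funext => x; rewrite -!EFinD; congr EFin; ring.
Qed.

Lemma L2D w h : L2 Omega w -> L2 Omega h -> L2 Omega (fun x => w x + h x).
Proof.
move=> Lw Lh; have L0 : L2 Omega (cst 0).
  by apply: (@L2_of_bounded _ 0) => // x; rewrite normr0.
rewrite (_ : (fun x => _) = (fun x => w x - (cst 0 x - h x))).
  by apply: L2B => //; exact: L2B.
by apply/funext => x; rewrite /= sub0r opprK.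
Qed.

Lemma test_function_bounded phi : test_function Omega phi -> exists M, forall x, `|phi x| <= M.
Proof.
move=> [sphi [K [cK KO K0]]].
have /compact_bounded[M [Mr HM]] : compact (phi @` K).
  apply: continuous_compact => //.
  by apply: continuous_subspaceT; exact: smooth_continuous.
exists (Num.max 0 (M + 1)) => x; rewrite le_max.
have [Kx|/K0 ->] := pselect (K x); last by rewrite normr0 lexx.
have M1 : M < M + 1 by rewrite ltrDl.
by apply/orP; right; apply: (HM _ M1); exists x.
Qed.

Lemma test_function_L2 phi : test_function Omega phi -> L2 Omega phi.
Proof.
move=> tphi; have [M HM] := test_function_bounded tphi; have [sphi _] := tphi.
apply: (L2_of_bounded _ HM); apply: measurable_funTS; apply: continuous_measurable_rV.
exact: smooth_continuous.
Qed.

Lemma test_function_pderiv i phi : test_function Omega phi -> test_function Omega (pderiv i phi).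
Proof.
move=> [sphi [K [cK KO K0]]]; split; first exact: smooth_pderiv.
exists K; split=> // x Kx; rewrite /pderiv -[RHS](derive_cst (0 : R) x (delta_mx 0 i : 'rV[R]_n)).
apply: near_eq_derive.
have oK : open (~` K).
  by apply: closed_openC; apply: compact_closed => //; exact: norm_hausdorff.
apply: filterS (open_nbhs_nbhs (conj oK Kx)) => y; exact: K0.
Qed.

(** Fundamental lemma of the calculus of variations: tensor bumps on a rational box whose closed box
    lies in [Omega] are test functions, so h vanishes almost everywhere there, and countably many
    such boxes cover [Omega]. *)
Lemma L2_test_ae_eq0 h : L2 Omega h ->
  (forall phi, test_function Omega phi -> \int[leb]_(x in Omega) (h x * phi x) = 0) ->
  ae_in Omega (fun x => h x = 0).
Proof.
move=> Lh h0.
pose Q := [set q : 'rV[rat]_n * 'rV[rat]_n |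
  cbox (@ratr_row R n q.1) (ratr_row q.2) `<=` Omega].
have aeQ q : Q q -> {ae leb, forall x, box (@ratr_row R n q.1) (ratr_row q.2) x -> h x = 0}.
  move=> Qq; have mb := measurable_box (@ratr_row R n q.1) (ratr_row q.2).
  have bO := subset_trans (@box_sub_cbox _ _ _ _) Qq.
  suff : ae_eq leb (box (@ratr_row R n q.1) (ratr_row q.2)) (EFin \o h) (cst 0%E).
    by apply: filterS => x /= H /H[].
  apply: tensor_integral_ae_eq0.
    by apply: integrableS (L2_integrable Lh).
  move=> phi bphi; rewrite -[RHS](h0 (tensor phi)).
    rewrite [LHS]Rintegral_mkcond [RHS]Rintegral_mkcond; congr Rintegral.
    apply/funext => x; rewrite !patchE; case: ifPn => [/[!inE] xb|/negP/[!inE]].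
      by rewrite mem_set//; exact: bO.
    by move=> xb; case: ifPn => // _; rewrite (tensor_out bphi)// mulr0.
  exact: test_function_tensor Qq bphi.
have /ae_forall_count : forall q, {ae leb, forall x, Q q ->
    box (@ratr_row R n q.1) (ratr_row q.2) x -> h x = 0}.
  move=> q; have [Qq|nQ] := pselect (Q q); last exact: aeW.
  by apply: filterS (aeQ q Qq) => x H _.
rewrite /ae_in; apply: filterS => x H Ox; have [q [qx qO]] := open_rat_box Omega_open Ox.
exact: H q qO qx.
Qed.

Lemma is_weak_partial_ae_unique i w h1 h2 : L2 Omega h1 -> L2 Omega h2 ->
  is_weak_partial Omega i w h1 -> is_weak_partial Omega i w h2 ->
  ae_in Omega (fun x => h1 x = h2 x).
Proof.
move=> L1 L2' w1 w2; have : ae_in Omega (fun x => h1 x - h2 x = 0).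
  apply: L2_test_ae_eq0 => [|phi tphi]; first exact: L2B.
  have Lphi := test_function_L2 tphi.
  under eq_Rintegral do rewrite mulrBl.
  rewrite RintegralB//; [|exact: L2_integrableM|exact: L2_integrableM].
  by have := w1 phi tphi; rewrite w2// => /oppr_inj ->; rewrite subrr.
by rewrite /ae_in; apply: filterS => x H Ox; apply/eqP; rewrite -subr_eq0 H.
Qed.

Lemma wpartialP i w : H1 Omega w ->
  L2 Omega (wpartial Omega i w) /\ is_weak_partial Omega i w (wpartial Omega i w).
Proof. by move=> [_ /(_ i)]; rewrite /wpartial => -[h Hh]; case: xgetP => [_ -> //|/(_ h)]. Qed.

Lemma wpartial_ae_eq i w h : L2 Omega h -> is_weak_partial Omega i w h ->
  ae_in Omega (fun x => wpartial Omega i w x = h x).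
Proof.
move=> Lh wh; rewrite /wpartial.
case: xgetP => [_ -> [L2' w']|/(_ h)]; last by case.
exact: is_weak_partial_ae_unique w' wh.
Qed.

Lemma test_function0 : test_function Omega (cst 0).
Proof.
split; last by exists set0; split=> //; exact: compact0.
move=> s x; have -> : foldr pderiv (cst 0 : 'rV[R]_n -> R) s = cst 0.
  by elim: s => //= i s ->; apply/funext => y; rewrite /pderiv derive_cst.
exact: differentiable_cst.
Qed.

Lemma is_weak_partial0 i : is_weak_partial Omega i (cst 0) (cst 0).
Proof.
move=> phi _; under eq_Rintegral do rewrite mul0r.
under [in RHS]eq_Rintegral do rewrite mul0r.
by rewrite Rintegral_cst// mul0r oppr0.
Qed.

(** The weak derivative of zero is a chosen representative, known to vanish only almost everywhere,
    so the integrals are compared rather than computed. *)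
Lemma H1sqnorm0 : H1sqnorm Omega (cst 0) = 0.
Proof.
have L0 := test_function_L2 test_function0.
have H10 : H1 Omega (cst 0) by split=> // i; exists (cst 0); split=> //; exact: is_weak_partial0.
rewrite /H1sqnorm big1 => [|i _].
  by under eq_Rintegral do rewrite expr0n; rewrite Rintegral_cst// mul0r addr0.
rewrite -[RHS](mul0r (fine (leb Omega))) -Rintegral_cst//.
have [[mw _] _] := wpartialP i H10.
apply: ae_eq_Rintegral => //; first exact: measurable_funX.
have := wpartial_ae_eq L0 (@is_weak_partial0 i); rewrite /ae_in; apply: filterS => x H Ox.
by rewrite H// expr0n.
Qed.

Lemma H10_of_test_function w : test_function Omega w -> H1 Omega w -> H10 Omega w.
Proof.
move=> tw Hw; split=> // e e0; exists w => //.
by rewrite subrr (_ : 0 = cst 0)// H1sqnorm0 sqrtr0.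
Qed.

Lemma H10_0 : H10 Omega (cst 0).
Proof.
have L0 := test_function_L2 test_function0.
apply: H10_of_test_function test_function0 _.
by split=> // i; exists (cst 0); split=> //; exact: is_weak_partial0.
Qed.

Section tensor.
Variables (a b : 'rV[R]_n) (phi : 'I_n -> R -> R).
Hypotheses (abO : cbox a b `<=` Omega) (bphi : forall i, bumpfun (a 0 i) (b 0 i) (phi i)).

Let ttensor : test_function Omega (tensor phi) := test_function_tensor abO bphi.

Lemma is_weak_partial_tensor i :
  is_weak_partial Omega i (tensor phi) (pderiv i (tensor phi)).
Proof. by move=> psi [spsi _]; exact: tensor_integration_by_parts abO bphi spsi. Qed.

Lemma H10_tensor : H10 Omega (tensor phi).
Proof.
apply: H10_of_test_function => //; split=> [|i]; first exact: test_function_L2.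
exists (pderiv i (tensor phi)); split; last exact: is_weak_partial_tensor.
exact/test_function_L2/test_function_pderiv.
Qed.

Definition tensor_field i : @vfield R n := fun x => tensor phi x *: delta_mx 0 i.

Lemma component_tensor_field i j :
  component (tensor_field i) j = if j == i then tensor phi else cst 0.
Proof.
apply/funext => x; rewrite /component /tensor_field !mxE eqxx/=.
by case: ifP => _; rewrite ?mulr1 ?mulr0.
Qed.

Lemma vH10_tensor_field i : vH10 Omega (tensor_field i).
Proof.
move=> j; rewrite component_tensor_field; case: ifP => _; [exact: H10_tensor|exact: H10_0].
Qed.

(** Only component i is nonzero, so the divergence isolates one partial derivative. Testing with
    these fields turns a statement on divergences into one on the weak gradient. *)
Lemma wdiv_tensor_field i :
  ae_in Omega (fun x => wdiv Omega (tensor_field i) x = pderiv i (tensor phi) x).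
Proof.
have L0 := test_function_L2 test_function0.
have Ld := test_function_L2 (test_function_pderiv i ttensor).
have /ae_forall_count : forall j, ae_in Omega (fun x =>
    wpartial Omega j (component (tensor_field i) j) x =
    if j == i then pderiv i (tensor phi) x else 0).
  move=> j; rewrite component_tensor_field; case: eqP => [->|_].
    exact: wpartial_ae_eq Ld (is_weak_partial_tensor i).
  exact: wpartial_ae_eq L0 (@is_weak_partial0 j).
rewrite /ae_in; apply: filterS => x H Ox; rewrite /wdiv (bigD1 i)//= big1 => [|j /negbTE ji].
  by rewrite H// eqxx addr0.
by rewrite H// ji.
Qed.

End tensor.

Lemma measurable_wdiv v : vH10 Omega v -> measurable_fun Omega (wdiv Omega v).
Proof.
move=> Hv; apply: measurable_sum => i; have [Hi _] := Hv i.
by have [[]] := wpartialP i Hi.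
Qed.

Lemma integral_wdiv_tensor_field w a b phi i : L2 Omega w ->
  cbox a b `<=` Omega -> (forall i, bumpfun (a 0 i) (b 0 i) (phi i)) ->
  \int[leb]_(x in Omega) (w x * wdiv Omega (tensor_field phi i) x) =
  \int[leb]_(x in Omega) (w x * pderiv i (tensor phi) x).
Proof.
move=> [mw _] abO bphi.
have [mt _] := test_function_L2 (test_function_pderiv i (test_function_tensor abO bphi)).
apply: ae_eq_Rintegral => //.
- apply: measurable_funM => //; apply: measurable_wdiv; exact: vH10_tensor_field abO bphi i.
- exact: measurable_funM.
- by have := wdiv_tensor_field abO bphi i; rewrite /ae_in; apply: filterS => x H Ox; rewrite H.
Qed.

Lemma integral_wdiv_solenoidal w v : L2 Omega w -> vH10 Omega v -> solenoidal Omega v ->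
  \int[leb]_(x in Omega) (w x * wdiv Omega v x) = 0.
Proof.
move=> [mw _] Hv sv; rewrite -[RHS](mul0r (fine (leb Omega))) -Rintegral_cst//.
apply: (ae_eq_Rintegral mOmega (measurable_funM mw (measurable_wdiv Hv)) (measurable_cst _)).
by move: sv; rewrite /solenoidal /ae_in; apply: filterS => x H Ox /=; rewrite H// mulr0.
Qed.

End weak_derivatives.

(** * From boxes to a connected open set *)

Section connected_constant.
Context {R : realType} {n : nat}.
Variable Omega : set 'rV[R]_n.
Hypotheses (Omega_open : open Omega) (Omega_bounded : bounded_set Omega)
  (Omega_connected : connected Omega).
Local Notation leb := (@leb R n).
Implicit Types (w : 'rV[R]_n -> R) (x : 'rV[R]_n) (q : 'rV[rat]_n * 'rV[rat]_n).

Let mOmega : measurable Omega := open_measurable_rV Omega_open.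

Let rbox q : set 'rV[R]_n := box (ratr_row q.1) (ratr_row q.2).
Let rcbox q : set 'rV[R]_n := cbox (ratr_row q.1) (ratr_row q.2).

Lemma weakly_constant_ae_eq0 w : L2 Omega w ->
  (forall a b phi i, cbox a b `<=` Omega -> (forall i, bumpfun (a 0 i) (b 0 i) (phi i)) ->
    \int[leb]_(x in Omega) (w x * pderiv i (tensor phi) x) = 0) ->
  \int[leb]_(x in Omega) w x = 0 ->
  ae_in Omega (fun x => w x = 0).
Proof.
move=> Lw w0 Iw; have iw := L2_integrable Omega_open Omega_bounded Lw.
pose aeq c q := {ae leb, forall x, rbox q x -> w x = c}.
have aec q x : rcbox q `<=` Omega -> rbox q x -> exists c, aeq c q.
  move=> qO qx; have mq : measurable (rbox q) by exact: measurable_box.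
  have bO : rbox q `<=` Omega by exact: subset_trans (@box_sub_cbox _ _ _ _) qO.
  have iwq : leb.-integrable (rbox q) (EFin \o w) by exact: integrableS iw.
  have kw : kills_pderiv (ratr_row q.1) (ratr_row q.2) w.
    move=> phi i bphi; rewrite -[RHS](w0 _ _ _ i qO bphi).
    rewrite [LHS]Rintegral_mkcond [RHS]Rintegral_mkcond; congr Rintegral.
    apply/funext => y; rewrite !patchE; case: ifPn => [/[!inE] yq|/negP/[!inE] yq].
      by rewrite mem_set//; exact: bO.
    by case: ifPn => // _; rewrite (@pderiv_tensor_out _ _ i _ _ phi y bphi)// mulr0.
  have [c hc] := kills_pderiv_ae_cst qx iwq kw; exists c.
  by apply: filterS hc => y /= H /H[].
(* [A c] gathers the rational boxes on which w equals c almost everywhere. These open sets cover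
   [Omega], and connectedness will leave only one of them. *)
pose A c := \bigcup_(q in [set q | rcbox q `<=` Omega /\ aeq c q]) rbox q.
have oA c : open (A c) by apply: bigcup_open => q _; exact: open_box.
have Acov x : Omega x -> exists c, A c x.
  move=> Ox; have [q [qx qO]] := open_rat_box Omega_open Ox.
  by have [c hc] := aec q x qO qx; exists c, q.
(* Two boxes that meet overlap in a nonempty open set, which has positive measure, so their
   constants agree. *)
have Adisj c d x : A c x -> A d x -> c = d.
  move=> [q [qO hc] qx] [r [rO hd] rx]; apply/eqP/negP => /negP cd.
  have oqr : open (rbox q `&` rbox r) by apply: openI; exact: open_box.
  have : (0 < leb (rbox q `&` rbox r))%E by exact: (leb_open_gt0 oqr (x := x)).
  rewrite measure_negligible ?ltxx//; first exact: open_measurable_rV.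
  have /negligibleS : {ae leb, forall y, ~ (rbox q `&` rbox r) y}.
    apply: filterS2 hc hd => y hc hd [qy ry].
    by move: cd; rewrite -(hc qy) -(hd ry) eqxx.
  by apply => y yqr /=; apply.
case: (eqVneq Omega set0) => [eO|/set0P[x0 Ox0]]; first by apply: aeW => x; rewrite eO.
have [c Acx0] := Acov _ Ox0.
have AO : A c = Omega.
  apply: Omega_connected.
  - by exists x0.
  - exists (A c) => //; apply/esym/setIidPr => x [q [qO _] /box_sub_cbox]; exact: qO.
  (* [A c] is relatively closed: within [Omega] its complement is the union of the other [A d]. *)
  - exists (~` \bigcup_(d in [set d | d != c]) A d).
      by apply: open_closedC; exact: bigcup_open.
    apply/seteqP; split=> x.
      move=> Acx; split; first by have [q [qO _] /box_sub_cbox] := Acx; exact: qO.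
      by move=> [d /= dc Adx]; rewrite (Adisj _ _ _ Adx Acx) eqxx in dc.
    move=> [Ox nx]; have [d Adx] := Acov _ Ox.
    by have [<-//|dc] := eqVneq d c; case: nx; exists d.
have wc : ae_in Omega (fun x => w x = c).
  have /ae_forall_count : forall q, {ae leb, forall x, aeq c q -> rbox q x -> w x = c}.
    move=> q; have [hc|nc] := pselect (aeq c q); last exact: aeW.
    by apply: filterS hc => x H _.
  rewrite /ae_in; apply: filterS => x H; rewrite -AO => -[q [qO hc] qx].
  exact: H q hc qx.
have : \int[leb]_(x in Omega) w x = c * fine (leb Omega).
  rewrite -Rintegral_cst//; apply: ae_eq_Rintegral => //; exact: L2_measurable.
rewrite Iw => /esym/eqP; rewrite mulf_eq0 => /orP[/eqP c0|].
  by move: wc; rewrite c0.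
rewrite gt_eqF//; apply: fine_gt0; rewrite (leb_open_gt0 Omega_open Ox0)/=.
exact: leb_bounded_lty.
Qed.

End connected_constant.

(** * Monotonicity of the derivative *)

Section frobenius.
Context {R : realType} {n : nat}.
Implicit Types (A B : 'M[R]_n).

Lemma dotmE A B : dotm A B = \sum_i \sum_j A i j * B i j.
Proof.
rewrite /dotm /mxtrace; apply: eq_bigr => i _; rewrite mxE.
by apply: eq_bigr => j _; rewrite mxE.
Qed.

Lemma dotmC A B : dotm A B = dotm B A.
Proof. by rewrite !dotmE; apply: eq_bigr => i _; apply: eq_bigr => j _; rewrite mulrC. Qed.

Lemma dotm_comb s t A B : dotm (s *: A - t *: B) (s *: A - t *: B) =
  s ^+ 2 * dotm A A - 2 * s * t * dotm A B + t ^+ 2 * dotm B B.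
Proof.
rewrite !dotmE !mulr_sumr -sumrB -big_split/=; apply: eq_bigr => i _.
rewrite !mulr_sumr -sumrB -big_split/=; apply: eq_bigr => j _; rewrite !mxE.
ring.
Qed.

Lemma dotm_ge0 A : 0 <= dotm A A.
Proof.
by rewrite dotmE; do 2!apply: sumr_ge0 => ? _; rewrite -expr2 sqr_ge0.
Qed.

Lemma dotm_eq0 A : dotm A A = 0 -> A = 0.
Proof.
rewrite dotmE => /eqP; rewrite psumr_eq0 => [/allP A0|i _]; last first.
  by apply: sumr_ge0 => j _; rewrite -expr2 sqr_ge0.
apply/matrixP => i j; have := A0 i (mem_index_enum i).
rewrite psumr_eq0 => [/allP/(_ j (mem_index_enum j))|k _]; last by rewrite -expr2 sqr_ge0.
by rewrite /= mulf_eq0 orbb mxE => /eqP.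
Qed.

Lemma normm_ge0 A : 0 <= normm A. Proof. exact: sqrtr_ge0. Qed.

Lemma sqr_normm A : normm A ^+ 2 = dotm A A.
Proof. by rewrite sqr_sqrtr// dotm_ge0. Qed.

(** Cauchy-Schwarz: the squared norm of |B| A - |A| B equals 2 |A| |B| (|A| |B| - A:B), and is
    nonnegative. The zero norms are set apart to allow division by |A| |B|. *)
Lemma dotm_le_normm A B : dotm A B <= normm A * normm B.
Proof.
have [A0|nA0] := eqVneq (normm A) 0.
  have -> : A = 0 by apply: dotm_eq0; rewrite -sqr_normm A0 expr0n.
  by rewrite dotmE big1 ?mulr_ge0 ?normm_ge0// => i _; rewrite big1// => j _; rewrite mxE mul0r.
have [B0|nB0] := eqVneq (normm B) 0.
  have -> : B = 0 by apply: dotm_eq0; rewrite -sqr_normm B0 expr0n.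
  by rewrite dotmE big1 ?mulr_ge0 ?normm_ge0// => i _; rewrite big1// => j _; rewrite mxE mulr0.
have AB0 : 0 < normm A * normm B by rewrite mulr_gt0// lt_def normm_ge0 andbT.
have := dotm_ge0 (normm B *: A - normm A *: B).
rewrite dotm_comb -!sqr_normm => h.
rewrite -subr_ge0 -(pmulr_rge0 _ AB0); nra.
Qed.

Variables (g beta : R).
Hypotheses (g_gt0 : 0 < g) (beta_gt0 : 0 < beta).

Definition yield A := Num.max g (beta * normm A).

Lemma yield_gt0 A : 0 < yield A.
Proof. by rewrite /yield lt_max g_gt0. Qed.

(** The expression is (A/m_A - B/m_B) : (A - B), with m the [yield] value, expanded into the four
    terms met in [dJ]. It is the scalar product (|A|/m_A - |B|/m_B) (|A| - |B|) plus a term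
    nonnegative by Cauchy-Schwarz. *)
Lemma flux_monotone A B :
  0 <= dotm A A / yield A - dotm A B / yield A - (dotm B A / yield B - dotm B B / yield B).
Proof.
rewrite (dotmC B A) -!sqr_normm.
have [a0 b0] := (normm_ge0 A, normm_ge0 B); have cs := dotm_le_normm A B.
have [mA mB] := (yield_gt0 A, yield_gt0 B).
set a := normm A in a0 cs *; set b := normm B in b0 cs *.
set p := dotm A B in cs *.
(* Scalar monotonicity of t / max(g, beta t). With denominators cleared, the product is zero if both
   norms are above the threshold g / beta and g (a - b)^2 if both are below; when they lie on
   opposite sides, this orders a and b. *)
have key : 0 <= (a / yield A - b / yield B) * (a - b).
  have -> : (a / yield A - b / yield B) * (a - b) =
      (a * yield B - b * yield A) * (a - b) / (yield A * yield B).
    by field; rewrite !gt_eqF.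
  apply: divr_ge0; last by rewrite mulr_ge0// ltW.
  have mono x y : beta * x < beta * y -> x <= y by rewrite ltr_pM2l// => /ltW.
  rewrite /yield -/a -/b; case: (leP g (beta * a)) => ga; case: (leP g (beta * b)) => gb.
  - by rewrite mulrCA [b * _]mulrCA [b * a]mulrC subrr mul0r.
  - have ba := mono _ _ (lt_le_trans gb ga).
    have -> : (a * g - b * (beta * a)) * (a - b) = a * ((g - beta * b) * (a - b)) by ring.
    by rewrite !mulr_ge0// subr_ge0// ltW.
  - have ab := mono _ _ (lt_le_trans ga gb).
    have -> : (a * (beta * b) - b * g) * (a - b) = b * ((g - beta * a) * (b - a)) by ring.
    by rewrite !mulr_ge0// subr_ge0// ltW.
  - by rewrite -mulrBl mulrAC -expr2 mulr_ge0 ?sqr_ge0 ?ltW.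
apply: le_trans key _; rewrite -subr_ge0.
have -> : a ^+ 2 / yield A - p / yield A - (p / yield B - b ^+ 2 / yield B) -
    (a / yield A - b / yield B) * (a - b) =
    ((yield A)^-1 + (yield B)^-1) * (a * b - p) by ring.
by rewrite mulr_ge0 ?subr_ge0// ltW// addr_gt0 ?invr_gt0.
Qed.

End frobenius.

(** Here l1 and l2 are the loads of the two test fields. They enter both equations in the same way
    and cancel on subtraction. *)
Lemma four_point_sum (R : comRingType) (c d a1 a2 a3 a4 b1 b2 b3 b4 l1 l2 : R) :
  c * a1 + d * b1 - l1 = c * a2 + d * b2 - l2 ->
  c * a3 + d * b3 - l1 = c * a4 + d * b4 - l2 ->
  c * (a1 - a2 - (a3 - a4)) + d * (b1 - b2 - (b3 - b4)) = 0.
Proof.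
move=> h1 h2.
transitivity ((c * a1 + d * b1 - l1) - (c * a2 + d * b2 - l2) -
  ((c * a3 + d * b3 - l1) - (c * a4 + d * b4 - l2))); first by ring.
by rewrite h1 h2 !subrr.
Qed.

(** * Dependence of the derivative on the symmetric gradient *)

Section optimality.
Context {R : realType} {n : nat}.
Variable Omega : set 'rV[R]_n.
Hypotheses (Omega_open : open Omega) (Omega_bounded : bounded_set Omega).
Variables (mu g beta : R) (f : @vfield R n).
Hypotheses (mu_gt0 : 0 < mu) (g_gt0 : 0 < g) (beta_gt0 : 0 < beta).
Local Notation leb := (@leb R n).
Local Notation E := (symgrad Omega).
Implicit Types (u v w : @vfield R n) (x : 'rV[R]_n).

Let mOmega : measurable Omega := open_measurable_rV Omega_open.

Lemma L2_symgrad u i j : vH10 Omega u -> L2 Omega (fun x => E u x i j).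
Proof.
move=> Hu; have [[[mij iij] _] [[mji iji] _]] :=
  (wpartialP j (proj1 (Hu i)), wpartialP i (proj1 (Hu j))).
pose s x := wpartial Omega j (component u i) x + wpartial Omega i (component u j) x.
have ms : measurable_fun Omega (fun x => 2^-1 * s x).
  exact: measurable_funM (measurable_cst _) (measurable_funD mij mji).
rewrite (_ : (fun x => _) = (fun x => 2^-1 * s x)); last first.
  by apply/funext => x; rewrite !mxE.
split; first exact: ms.
apply: (le_integrable mOmega _ _ (integrableD mOmega iij iji)).
  by apply/measurable_EFinP; exact: measurable_funX ms.
move=> x _; rewrite /s {ms s}; rewrite -EFinD /= lee_fin !ger0_norm ?addr_ge0 ?sqr_ge0//.
set s := wpartial _ _ _ x; set t := wpartial _ _ _ x.
rewrite -subr_ge0 (_ : _ - _ = 2^-1 * (s ^+ 2 + t ^+ 2) + 4^-1 * (s - t) ^+ 2); last by field.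
by rewrite addr_ge0// mulr_ge0 ?addr_ge0 ?sqr_ge0.
Qed.

Lemma integrable_dotm_symgrad u v : vH10 Omega u -> vH10 Omega v ->
  leb.-integrable Omega (fun x => (dotm (E u x) (E v x))%:E).
Proof.
move=> Hu Hv; rewrite (_ : (fun x => _) =
    (fun x => \sum_i \sum_j (E u x i j * E v x i j)%:E)%E).
  apply: integrable_sum => // i _; apply: integrable_sum => // j _.
  by apply: L2_integrableM; [|exact: L2_symgrad|exact: L2_symgrad].
apply/funext => x; rewrite dotmE -sumEFin; apply: eq_bigr => i _.
by rewrite -sumEFin.
Qed.

Let measurable_dotm u v : vH10 Omega u -> vH10 Omega v ->
  measurable_fun Omega (fun x => dotm (E u x) (E v x)).
Proof.
move=> Hu Hv; apply/measurable_EFinP.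
exact: (measurable_int _ (integrable_dotm_symgrad Hu Hv)).
Qed.

Let my := @yield R n g beta.

(** The matrix enters only through the scalar A:A, so measurability reduces to continuity of a
    function of one real variable, whose denominator is at least g. *)
Let measurable_yield u : vH10 Omega u -> measurable_fun Omega (fun x => (my (E u x))^-1).
Proof.
move=> Hu; pose k (t : R) := (Num.max g (beta * Num.sqrt t))^-1.
rewrite (_ : (fun x => _) = k \o (fun x => dotm (E u x) (E u x)))//.
apply: measurableT_comp; last exact: measurable_dotm.
pose k0 (t : R) := Num.max g (beta * Num.sqrt t).
apply: continuous_measurable_fun => t; apply: (@continuousV _ _ k0).
  by rewrite gt_eqF// lt_max g_gt0.
apply: (@continuous_max _ _ (cst g) (fun t => beta * Num.sqrt t)); first exact: cvg_cst.
by apply: continuousM; [exact: cvg_cst|exact: sqrt_continuous].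
Qed.

Lemma integrable_flux u v w : vH10 Omega u -> vH10 Omega v -> vH10 Omega w ->
  leb.-integrable Omega (fun x => (dotm (E v x) (E w x) / my (E u x))%:E).
Proof.
move=> Hu Hv Hw; apply: (@integrable_mul_bounded _ _ _ _ _ g^-1) => //.
- exact: integrable_dotm_symgrad.
- exact: measurable_yield.
- move=> x; have y0 : 0 < my (E u x) by exact: yield_gt0.
  rewrite ger0_norm ?invr_ge0 ?(ltW y0)// lef_pV2 ?posrE//.
  by rewrite /my /yield le_max lexx.
Qed.

Lemma dJ_congr u v w : vH10 Omega u -> vH10 Omega v -> vH10 Omega w ->
  ae_in Omega (fun x => E u x = E v x) ->
  dJ Omega mu g beta f u w = dJ Omega mu g beta f v w.
Proof.
move=> Hu Hv Hw; rewrite /dJ -/my.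
have := measurable_yield Hv; have := measurable_yield Hu.
have := measurable_dotm Hv Hw; have := measurable_dotm Hu Hw.
move: (E u) (E v) (E w) => eu ev ew mu1 mv1 mu2 mv2 uv.
rewrite (ae_eq_Rintegral mOmega mu1 mv1); last first.
  by move: uv; rewrite /ae_in; apply: filterS => x H Ox; rewrite H.
rewrite (ae_eq_Rintegral mOmega (measurable_funM mu1 mu2) (measurable_funM mv1 mv2))//.
by move: uv; rewrite /ae_in; apply: filterS => x H Ox /=; rewrite H.
Qed.

(* Testing only with [u] and [v], instead of [u - v], avoids the linearity of
   [dJ Omega mu g beta f u], hence that of [wpartial], which holds only almost
   everywhere. *)
Lemma symgrad_ae_unique u v : vH10 Omega u -> vH10 Omega v ->
  dJ Omega mu g beta f u u = dJ Omega mu g beta f u v ->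
  dJ Omega mu g beta f v u = dJ Omega mu g beta f v v ->
  ae_in Omega (fun x => E u x = E v x).
Proof.
move=> Hu Hv; rewrite /dJ -/my => eu ev.
have iuu := integrable_dotm_symgrad Hu Hu.
have iuv := integrable_dotm_symgrad Hu Hv.
have ivu := integrable_dotm_symgrad Hv Hu.
have ivv := integrable_dotm_symgrad Hv Hv.
have kuu := integrable_flux Hu Hu Hu.
have kuv := integrable_flux Hu Hu Hv.
have kvu := integrable_flux Hv Hv Hu.
have kvv := integrable_flux Hv Hv Hv.
move: (E u) (E v) iuu iuv ivu ivv kuu kuv kvu kvv eu ev =>
  eu ev iuu iuv ivu ivv kuu kuv kvu kvv dJu dJv.
have iB (p q : 'rV[R]_n -> R) : leb.-integrable Omega (EFin \o p) ->
    leb.-integrable Omega (EFin \o q) ->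
    leb.-integrable Omega (EFin \o (fun x => p x - q x)).
  move=> ip iq; rewrite (_ : _ \o _ = ((EFin \o p) \- (EFin \o q))%E)//.
  exact: integrableB.
(* F is the viscous contribution and G the plastic one to <J'(u) - J'(v), u - v>. *)
pose F x := dotm (eu x - ev x) (eu x - ev x).
pose G x := dotm (eu x) (eu x) / my (eu x) - dotm (eu x) (ev x) / my (eu x) -
  (dotm (ev x) (eu x) / my (ev x) - dotm (ev x) (ev x) / my (ev x)).
have IG : \int[leb]_(x in Omega) G x =
    \int[leb]_(x in Omega) (dotm (eu x) (eu x) / my (eu x))
    - \int[leb]_(x in Omega) (dotm (eu x) (ev x) / my (eu x))
    - (\int[leb]_(x in Omega) (dotm (ev x) (eu x) / my (ev x))
    - \int[leb]_(x in Omega) (dotm (ev x) (ev x) / my (ev x))).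
  rewrite RintegralB//; [|exact: iB|exact: iB].
  by rewrite RintegralB// RintegralB.
have FE : F = (fun x => dotm (eu x) (eu x) - dotm (eu x) (ev x) -
    (dotm (ev x) (eu x) - dotm (ev x) (ev x))).
  apply/funext => x; have := dotm_comb 1 1 (eu x) (ev x).
  by rewrite !scale1r /F => ->; rewrite (dotmC (ev x) (eu x)); ring.
have IF : \int[leb]_(x in Omega) F x =
    \int[leb]_(x in Omega) (dotm (eu x) (eu x))
    - \int[leb]_(x in Omega) (dotm (eu x) (ev x))
    - (\int[leb]_(x in Omega) (dotm (ev x) (eu x))
    - \int[leb]_(x in Omega) (dotm (ev x) (ev x))).
  rewrite FE RintegralB//; [|exact: iB|exact: iB].
  by rewrite RintegralB// RintegralB.
have F0 x : 0 <= F x by exact: dotm_ge0.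
have G0 : 0 <= \int[leb]_(x in Omega) G x.
  by apply: Rintegral_ge0 => x _; exact: flux_monotone.
have IF0 : \int[leb]_(x in Omega) F x = 0.
  apply/eqP; rewrite eq_le Rintegral_ge0// andbT.
  (* Both terms of this vanishing sum are nonnegative and mu > 0, so the integral of F is also at
     most 0. *)
  have F2 : 2 * mu * \int[leb]_(x in Omega) F x + g * beta * \int[leb]_(x in Omega) G x = 0.
    rewrite IF IG; exact: four_point_sum dJu dJv.
  have : 0 <= g * beta * \int[leb]_(x in Omega) G x by rewrite !mulr_ge0// ltW.
  have mu2 : 0 < 2 * mu by rewrite mulr_gt0.
  by rewrite -(pmulr_rle0 _ mu2) -[X in _ -> X <= 0]addr0 -[X in _ -> _ <= X]F2 lerD2l.
have iF : leb.-integrable Omega (EFin \o F).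
  by rewrite FE; apply: (iB) => //; exact: iB.
have : (\int[leb]_(x in Omega) `|(EFin \o F) x| = 0)%E.
  rewrite -[RHS]/(0%:E) -IF0 fineK ?integrable_fin_num//.
  by apply: eq_integral => x _; rewrite gee0_abs//= lee_fin.
move/ae_eq_integral_abs => /(_ mOmega (measurable_int _ iF)).
rewrite /ae_in; apply: filterS => x /= H /H[] /dotm_eq0/eqP.
by rewrite subr_eq0 => /eqP.
Qed.

End optimality.

(** * Equality of the pressure and the opposite multiplier *)

Unset Implicit Arguments.

Theorem mainTheorem3 (R : realType) (n : nat) (hn : n = 2%N \/ n = 3%N)
  (Omega : set 'rV[R]_n)
  (Omega_open : open Omega) (Omega_bounded : bounded_set Omega)
  (Omega_connected : connected Omega)
  (Omega_lipschitz : lipschitz_boundary Omega)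
  (mu g beta : R) (mu_gt0 : 0 < mu) (g_gt0 : 0 < g) (beta_gt0 : 0 < beta)
  (f : 'rV[R]_n -> 'rV[R]_n) (hf : admissible_load Omega f)
  (u : 'rV[R]_n -> 'rV[R]_n) (p : 'rV[R]_n -> R)
  (u_min : is_minimizer (J Omega mu g beta f)
     [set v | vH10 Omega v /\ solenoidal Omega v] u)
  (p_L20 : L20 Omega p)
  (p_pressure : forall v, vH10 Omega v ->
     dJ Omega mu g beta f u v = \int[leb n]_(x in Omega) (p x * wdiv Omega v x))
  (u_ : R -> 'rV[R]_n -> 'rV[R]_n) (zeta : R -> 'rV[R]_n -> R)
  (u_min_ : forall sigma, 0 < sigma ->
     is_minimizer (Jpen Omega mu g beta f sigma) [set v | vH10 Omega v] (u_ sigma))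
  (zeta_L20 : forall sigma, 0 < sigma -> L20 Omega (zeta sigma))
  (zeta_le : forall sigma, 0 < sigma ->
     ae_in Omega (fun x => `|zeta sigma x| <= sigma))
  (zeta_multiplier : forall sigma, 0 < sigma -> forall v, vH10 Omega v ->
     - dJ Omega mu g beta f (u_ sigma) v =
     \int[leb n]_(x in Omega) (zeta sigma x * wdiv Omega v x))
  (sigma0 : R) (sigma0_gt0 : 0 < sigma0)
  (hsigma0 : forall sigma, sigma0 <= sigma -> solenoidal Omega (u_ sigma)) :
  forall sigma, sigma0 <= sigma -> ae_in Omega (fun x => - zeta sigma x = p x).
Proof.
move=> sigma hs; have s_gt0 : 0 < sigma by exact: lt_le_trans hs.
have [[Hu su] _] := u_min; have [/= Hs _] := u_min_ sigma s_gt0.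
have ss := hsigma0 sigma hs.
have [Lp Ip] := p_L20; have [Lz Iz] := zeta_L20 sigma s_gt0.
(* Against solenoidal fields the pressure and the multiplier integrate to zero, so both derivatives
   vanish on u and on [u_ sigma]. *)
have dJu v : vH10 Omega v -> solenoidal Omega v -> dJ Omega mu g beta f u v = 0.
  by move=> Hv sv; rewrite p_pressure// integral_wdiv_solenoidal.
have dJs v : vH10 Omega v -> solenoidal Omega v -> dJ Omega mu g beta f (u_ sigma) v = 0.
  by move=> Hv sv; apply/eqP; rewrite -oppr_eq0 zeta_multiplier// integral_wdiv_solenoidal.
have Euv : ae_in Omega (fun x => symgrad Omega u x = symgrad Omega (u_ sigma) x).
  apply: (@symgrad_ae_unique _ _ _ Omega_open mu g beta f) => //.
  - by rewrite dJu// dJu.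
  - by rewrite dJs// dJs.
have iL := @L2_integrableM _ _ _ Omega_open.
have Lpz := L2D Omega_open Omega_bounded Lp Lz.
have : ae_in Omega (fun x => p x + zeta sigma x = 0).
  apply: weakly_constant_ae_eq0 => // [a b phi i abO bphi|]; last first.
    rewrite RintegralD ?Ip ?Iz ?addr0//; first exact: open_measurable_rV.
    - exact: L2_integrable.
    - exact: L2_integrable.
  have Hv := vH10_tensor_field Omega_open Omega_bounded abO bphi i.
  have Ld := test_function_L2 Omega_open Omega_bounded
    (test_function_pderiv i (test_function_tensor abO bphi)).
  under eq_Rintegral do rewrite mulrDl.
  rewrite RintegralD; [|exact: open_measurable_rV|exact: iL|exact: iL].
  rewrite -!(integral_wdiv_tensor_field Omega_open Omega_bounded i _ abO bphi)//.
  (* The two integrals are <J'(u), v> and -<J'(u_sigma), v>. They cancel because the derivative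
     depends on its base point only through the symmetric gradient. *)
  rewrite -p_pressure// -zeta_multiplier//.
  by rewrite (dJ_congr _ _ _ _ _ Hu Hs Hv Euv)// subrr.
rewrite /ae_in; apply: filterS => x pz0 Ox.
by apply/esym/eqP; rewrite -addr_eq0 pz0.
Qed.
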